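(* Let $w=(w_1,\ldots,w_m)$ be positive weights with $w_1+\cdots+w_m=1$, and let $A_1,\ldots,A_m\in\mathrm{UT}_4$. Then the $w$-weighted Karcher mean on $\mathrm{UT}_4$ is given by $X=G(w;A_1,\ldots,A_m)=DX'$, where $X'=G(w;A_{(1)},\ldots,A_{(m)})=[x'_{ij}]$ is unipotent upper triangular such that $$x'_{12}=\frac1{c_{12}}\sum_{i=1}^m w_i\log^{[1]}\bigl(a^{(i)}_{11},a^{(i)}_{22}\bigr)a^{(i)}_{12},\qquad x'_{23}=\frac1{c_{23}}\sum_{i=1}^m w_i\log^{[1]}\bigl(a^{(i)}_{22},a^{(i)}_{33}\bigr)a^{(i)}_{23},$$ $$x'_{13}=\frac1{c_{13}}\sum_{i=1}^m w_i\Bigl[\log^{[1]}\bigl(a^{(i)}_{11},a^{(i)}_{33}\bigr)\bigl(a^{(i)}_{13}-x'_{12}a^{(i)}_{23}+x'_{12}x'_{23}a^{(i)}_{33}\bigr)+\log^{[2]}\bigl(a^{(i)}_{11},a^{(i)}_{22},a^{(i)}_{33}\bigr)\bigl(a^{(i)}_{12}-x'_{12}a^{(i)}_{22}\bigr)\bigl(a^{(i)}_{23}-x'_{23}a^{(i)}_{33}\bigr)\Bigr],$$ and $$x'_{34}=\frac1{c_{34}}\sum_{i=1}^m w_i\log^{[1]}\bigl(a^{(i)}_{33},a^{(i)}_{44}\bigr)a^{(i)}_{34},$$ $$x'_{24}=\frac1{c_{24}}\sum_{i=1}^m w_i\Bigl[\log^{[1]}\bigl(a^{(i)}_{22},a^{(i)}_{44}\bigr)\bigl(a^{(i)}_{24}-x'_{23}a^{(i)}_{34}+x'_{23}x'_{34}a^{(i)}_{44}\bigr)+\log^{[2]}\bigl(a^{(i)}_{22},a^{(i)}_{33},a^{(i)}_{44}\bigr)\bigl(a^{(i)}_{23}-x'_{23}a^{(i)}_{33}\bigr)\bigl(a^{(i)}_{34}-x'_{34}a^{(i)}_{44}\bigr)\Bigr],$$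 $$\begin{aligned}x'_{14}=\frac1{c_{14}}\sum_{i=1}^m w_i\Bigl[&\log^{[1]}\bigl(a^{(i)}_{11},a^{(i)}_{44}\bigr)\bigl(a^{(i)}_{14}-x'_{12}a^{(i)}_{24}-x'_{13}a^{(i)}_{34}+x'_{12}x'_{23}a^{(i)}_{34}+x'_{12}x'_{24}a^{(i)}_{44}+x'_{13}x'_{34}a^{(i)}_{44}-x'_{12}x'_{23}x'_{34}a^{(i)}_{44}\bigr)\\&+\log^{[2]}\bigl(a^{(i)}_{11},a^{(i)}_{22},a^{(i)}_{44}\bigr)\bigl(a^{(i)}_{12}-x'_{12}a^{(i)}_{22}\bigr)\bigl(a^{(i)}_{24}-x'_{23}a^{(i)}_{34}-x'_{24}a^{(i)}_{44}+x'_{23}x'_{34}a^{(i)}_{44}\bigr)\\&+\log^{[2]}\bigl(a^{(i)}_{11},a^{(i)}_{33},a^{(i)}_{44}\bigr)\bigl(a^{(i)}_{13}-x'_{12}a^{(i)}_{23}-x'_{13}a^{(i)}_{33}+x'_{12}x'_{23}a^{(i)}_{33}\bigr)\bigl(a^{(i)}_{34}-x'_{34}a^{(i)}_{44}\bigr)\\&+\log^{[3]}\bigl(a^{(i)}_{11},a^{(i)}_{22},a^{(i)}_{33},a^{(i)}_{44}\bigr)\bigl(a^{(i)}_{12}-x'_{12}a^{(i)}_{22}\bigr)\bigl(a^{(i)}_{23}-x'_{23}a^{(i)}_{33}\bigr)\bigl(a^{(i)}_{34}-x'_{34}a^{(i)}_{44}\bigr)\Bigr].\end{aligned}$$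
   Context: $\mathrm{UT}_n$ is the Lie group of $n\times n$ real upper triangular matrices with positive diagonal entries; $\log:\mathrm{UT}_n\to\mathfrak{ut}_n$ is the inverse of the matrix exponential $\exp:\mathfrak{ut}_n\to\mathrm{UT}_n$, where $\mathfrak{ut}_n$ is the space of real upper triangular $n\times n$ matrices, and $A^{w}=\exp(w\log A)$. The $w$-weighted Karcher mean $G(w;A_1,\ldots,A_m)$ is the (unique) solution $X\in\mathrm{UT}_n$ of $\sum_{i=1}^m w_i\log(X^{-1}A_i)=0$. ''Unipotent upper triangular'' means upper triangular with all diagonal entries equal to $1$. Here $D:=\mathrm{diag}(A_1^{w_1}\cdots A_m^{w_m})$ (the diagonal matrix formed from the diagonal entries), $A_{(i)}:=D^{-1}A_i=[a^{(i)}_{pq}]$, and for $p<q$ $$c_{pq}:=\sum_{i=1}^m w_i\,a^{(i)}_{qq}\,\log^{[1]}\bigl(a^{(i)}_{pp},a^{(i)}_{qq}\bigr).$$ $\log^{[k]}$ is the $k$-th divided difference of the scalar logarithm $f=\log$: $f^{[0]}(a_1)=f(a_1)$ and for $k\ge1$, $f^{[k]}(a_1,\ldots,a_{k+1})=\frac{f^{[k-1]}(a_1,\ldots,a_k)-f^{[k-1]}(a_2,\ldots,a_{k+1})}{a_1-a_{k+1}}$ if $a_1\ne a_{k+1}$, and $f^{[k]}(a_1,\ldots,a_{k+1})=\frac{\partial f^{[k-1]}}{\partial x_1}(a_1,\ldots,a_k)$ if $a_1=a_{k+1}$. *)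

(* Defs.v *)
From mathcomp Require Import all_boot all_order all_algebra.
From mathcomp Require Import all_classical all_reals all_analysis.
Import Order.TTheory GRing.Theory Num.Theory numFieldNormedType.Exports.

Set Implicit Arguments.
Unset Strict Implicit.
Unset Printing Implicit Defensive.

Local Open Scope classical_set_scope.
Local Open Scope ring_scope.

Section matrices.
Context {R : realType}.

(* [is_trig_mx] means lower triangular, hence the transpose. *)
Definition ut n : set 'M[R]_n := [set M | is_trig_mx M^T].

Definition UT n : set 'M[R]_n := [set M | ut M /\ forall i, 0 < M i i].

Definition unipotent_ut n (M : 'M[R]_n) : Prop := ut M /\ forall i, M i i = 1.

Definition expm n (M : 'M[R]_n) : 'M[R]_n :=
  limn (series (fun k => k`!%:R^-1 *: M ^+ k)).

(* The inverse of [expm] restricted to [ut n]. *)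
Definition logm n : 'M[R]_n -> 'M[R]_n := 'pinv_(fun=> 0) (@ut n) (@expm n).

Definition powm n (M : 'M[R]_n) (t : R) : 'M[R]_n := expm (t *: logm M).

Definition diag_part n (M : 'M[R]_n) : 'M[R]_n := diag_mx (\row_i M i i).

Definition karcher_eq m n (w : 'I_m -> R) (A : 'I_m -> 'M[R]_n) : set 'M[R]_n :=
  [set X | UT X /\ \sum_(i < m) w i *: logm (invmx X *m A i) = 0].

(* The unique solution of the Karcher equation. The default value 0, which is
   not in [UT n] when n > 0, is taken if there is no solution or more than
   one. *)
Definition karcher m n (w : 'I_m -> R) (A : 'I_m -> 'M[R]_n) : 'M[R]_n :=
  xget 0 [set X | unique (karcher_eq w A) X].

(* \prod is the ordered product of the (noncommutative) ring of matrices. *)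
Definition diag_mean m n (w : 'I_m -> R) (A : 'I_m -> 'M[R]_n) : 'M[R]_n :=
  diag_part (\prod_(i < m) powm (A i) (w i)).

(* Entries numbered from 1. *)
Definition entry n (M : 'M[R]_n.+1) (p q : nat) : R :=
  M (inord p.-1) (inord q.-1).

End matrices.

Notation "M .e[ p , q ]" := (entry M p%N q%N)
  (at level 1, left associativity, format "M .e[ p ,  q ]") : ring_scope.

(* k-th divided difference of f at the points a`_0, ..., a`_k; later entries
   of the sequence are ignored. *)
Fixpoint divdiff {R : realType} (f : R -> R) (k : nat) (a : seq R) : R :=
  if k is k'.+1 then
    if a`_0 != a`_k then
      (divdiff f k' a - divdiff f k' (behead a)) / (a`_0 - a`_k)
    else derive1 (fun x : R => divdiff f k' (x :: behead a)) a`_0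
  else f a`_0.

Definition log1 {R : realType} (a1 a2 : R) : R :=
  divdiff (@ln R) 1 [:: a1; a2].

Definition log2 {R : realType} (a1 a2 a3 : R) : R :=
  divdiff (@ln R) 2 [:: a1; a2; a3].

Definition log3 {R : realType} (a1 a2 a3 a4 : R) : R :=
  divdiff (@ln R) 3 [:: a1; a2; a3; a4].

Definition log1_coef {R : realType} m n (w : 'I_m -> R)
    (A : 'I_m -> 'M[R]_n.+1) (p q : nat) : R :=
  \sum_(i < m) w i * (A i).e[q, q] * log1 (A i).e[p, p] (A i).e[q, q].

(* Main.v *)
Require Import Defs.
From mathcomp Require Import all_boot all_order all_algebra.
From mathcomp Require Import all_classical all_reals all_analysis.
From mathcomp Require Import ring lra.
Import Order.TTheory GRing.Theory Num.Theory numFieldNormedType.Exports.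
Local Open Scope classical_set_scope.
Local Open Scope ring_scope.

(** On matrices with distinct eigenvalues, the divided-difference formula for
    the entries of the logarithm is verified by diagonalization, M = P D P^-1
    with P unipotent. The general case follows by perturbing the diagonal, since
    [expm] is continuous and the divided differences of log are jointly
    continuous: they are (-1)^(k-1) int_0^1 s^(k-1) / prod_i (1 + s (x_i - 1)) ds.
    As log[1] > 0, the formula can be solved entry by entry, one superdiagonal
    at a time, for the matrix; hence [expm] is a bijection from [ut] to [UT]
    whose inverse is the formula. The Karcher equation for the normalized
    matrices D^-1 A_i forces a unit diagonal and then becomes, along the
    superdiagonals, a triangular system of scalar equations in which x_pq has
    the positive coefficient c_pq. *)

(** * Divided differences of the logarithm as integrals *)

Section LogDividedDifferences.
Context {R : realType}.
Implicit Types (x y a s : R) (xs ys zs : seq R).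

Local Notation pos := (fun x : R => 0 < x).

(* At a singleton, [(size xs).-2] is truncated to 0: the kernel is then
   1 / (1 + s (x - 1)), to be multiplied by x - 1 as in [integral_log]. *)
Definition log_kernel xs s : R :=
  (- s) ^+ (size xs).-2 * \prod_(x <- xs) (1 + s * (x - 1))^-1.

(** At two or more points the kernel is, for fixed s, the divided difference in x of (x - 1) / (1 +
    s (x - 1)), whose integral over s is ln x. Unlike the recursion of [divdiff], the integral is
    visibly symmetric and treats coinciding points like any others. *)
Definition logdd xs : R :=
  if xs is [:: x] then ln x
  else \int[lebesgue_measure]_(s in `[0, 1]) log_kernel xs s.
Arguments logdd : simpl never.

Lemma segment_gt0 x s : 0 < x -> 0 <= s <= 1 -> 0 < 1 + s * (x - 1).
Proof.
move=> x0 /andP[s0 s1].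
have -> : 1 + s * (x - 1) = (1 - s) + s * x by ring.
have [->|sn0] := eqVneq s 0; first by rewrite subr0 mul0r addr0.
by rewrite ltr_wpDl ?subr_ge0// mulr_gt0// lt_neqAle eq_sym sn0.
Qed.

Lemma continuous_log_kernel xs s : all pos xs -> 0 <= s <= 1 ->
  {for s, continuous (log_kernel xs)}.
Proof.
move=> xs0 s01.
rewrite /log_kernel; apply: cvgM.
  by apply: (@cvg_comp _ _ _ (fun s => - s) (fun s => s ^+ _));
    [apply: cvgN; exact: cvg_id|exact: exprn_continuous].
elim: xs xs0 => [_|x xs IH /= /andP[x0 /IH cxs]].
  by under eq_cvg do rewrite big_nil; rewrite big_nil; exact: cvg_cst.
under eq_cvg do rewrite big_cons; rewrite big_cons; apply: cvgM => //.
apply: cvgV; first by rewrite gt_eqF// segment_gt0.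
by apply: cvgD; [exact: cvg_cst|apply: cvgM; [exact: cvg_id|exact: cvg_cst]].
Qed.

Lemma integrable_log_kernel xs : all pos xs ->
  lebesgue_measure.-integrable `[0, 1] (EFin \o log_kernel xs).
Proof.
move=> xs0; apply: continuous_compact_integrable; first exact: segment_compact.
apply: continuous_in_subspaceT => s /[!inE]/=; rewrite in_itv/=.
exact: continuous_log_kernel.
Qed.

Lemma logddE x y zs : logdd (x :: y :: zs) =
  \int[lebesgue_measure]_(s in `[0, 1]) log_kernel (x :: y :: zs) s.
Proof. by []. Qed.

(** Allows any two points to be brought to the front, where [logdd_rec] acts. *)
Lemma perm_logdd xs ys : perm_eq xs ys -> logdd xs = logdd ys.
Proof.
move=> xsys; have sxy := perm_size xsys.
have kE : log_kernel xs = log_kernel ys.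
  by apply/funext => s; rewrite /log_kernel sxy (perm_big _ xsys).
case: xs ys xsys sxy kE => [|x [|x' xs]] [|y [|y' ys]]//=.
- by move=> /perm_mem/(_ x); rewrite !inE eqxx => /esym/eqP ->.
- by rewrite /logdd => _ _ ->.
Qed.

(** The antiderivative in s is ln (1 + s (x - 1)), which runs from 0 to ln x. Keeping the factor x -
    1 under the integral avoids an exception at x = 1. *)
Lemma integral_log x : 0 < x ->
  \int[lebesgue_measure]_(s in `[0, 1]) ((x - 1) * log_kernel [:: x] s) = ln x.
Proof.
move=> x0; have xs0 : all pos [:: x] by rewrite /= x0.
have Dln s : 0 <= s <= 1 ->
    is_derive s 1 (fun s => ln (1 + s * (x - 1))) ((x - 1) * log_kernel [:: x] s).
  move=> s01; have u0 := segment_gt0 _ _ x0 s01.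
  have Du : is_derive s 1 (fun s => 1 + s * (x - 1)) (x - 1).
    by apply: is_derive_eq; rewrite /GRing.scale/=; ring.
  rewrite /log_kernel/= expr0 mul1r big_seq1 [(x - 1) * _]mulrC.
  exact: (@is_derive1_comp _ (@ln R) (fun s => 1 + s * (x - 1)) s _ _ (is_derive1_ln u0) Du).
have cln s : 0 <= s <= 1 -> {for s, continuous (fun s => ln (1 + s * (x - 1)))}.
  by move=> /Dln [dln _]; apply/differentiable_continuous/derivable1_diffP.
rewrite /Rintegral (@continuous_FTC2 _ _ (fun s => ln (1 + s * (x - 1)))) //=.
- by rewrite mul0r addr0 ln1 subr0 mul1r addrC subrK.
- apply: continuous_in_subspaceT => s /[!inE]/=; rewrite in_itv/= => s01.
  by apply: cvgM; [exact: cvg_cst|exact: continuous_log_kernel].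
- split.
  + by move=> s; rewrite in_itv/= => /andP[s0 s1]; apply: ex_derive; apply: Dln; rewrite !ltW.
  + by apply: cvg_at_right_filter; apply: cln; rewrite lexx ler01.
  + by apply: cvg_at_left_filter; apply: cln; rewrite lexx ler01.
- by move=> s; rewrite in_itv/= => /andP[s0 s1]; rewrite derive1E;
  apply: derive_val; apply: Dln; rewrite !ltW.
Qed.

(** An identity of integrands: with u = 1 + s (x - 1) and v = 1 + s (y - 1), 1/u - 1/v = - s (x - y)
    / (u v). The form without division also covers x = y. *)
Lemma logdd_rec x y zs : all pos (x :: y :: zs) ->
  (x - y) * logdd (x :: y :: zs) = logdd (x :: zs) - logdd (y :: zs).
Proof.
move=> /= /and3P[x0 y0 zs0].
rewrite logddE -RintegralZl//; last by apply: integrable_log_kernel; rewrite /= x0 y0.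
(* For empty [zs] the right-hand side consists of singletons, whose logarithms become integrals by
   [integral_log]. *)
have [zsE|zn0] := eqVneq zs [::].
  have ik z : 0 < z -> lebesgue_measure.-integrable `[0, 1]
      (EFin \o (fun s => (z - 1) * log_kernel [:: z] s)).
    move=> z0; rewrite (_ : EFin \o _ =
        (fun s => (z - 1)%:E * (EFin \o log_kernel [:: z]) s)%E).
      by apply: integrableZl => //; apply: integrable_log_kernel; rewrite /= z0.
    by apply/funext => s /=; rewrite EFinM.
  rewrite zsE /logdd -!integral_log// -RintegralB//; try exact: ik.
  apply: eq_Rintegral => s; rewrite inE/= in_itv/= => s01.
  have u0 := segment_gt0 _ _ x0 s01; have v0 := segment_gt0 _ _ y0 s01.
  rewrite /log_kernel /= expr0 !big_cons !big_nil; field.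
  by rewrite !gt_eqF.
have lE z : logdd (z :: zs) = \int[lebesgue_measure]_(s in `[0, 1]) log_kernel (z :: zs) s.
  by case: zs zn0 {zs0}.
rewrite !lE -RintegralB//; try by apply: integrable_log_kernel; rewrite /= ?x0 ?y0.
apply: eq_Rintegral => s; rewrite inE/= in_itv/= => s01.
have u0 := segment_gt0 _ _ x0 s01; have v0 := segment_gt0 _ _ y0 s01.
rewrite /log_kernel /= !big_cons.
case: zs zn0 {zs0 lE} => // z zs _; rewrite /= exprS; field.
by rewrite !gt_eqF.
Qed.

(** On [0, 1] each factor satisfies 1 / (1 + s (z - 1)) <= 1 + 1/z, since (1 + 1/z) (1 + s (z - 1))
    = 1 + (1 - s)/z + s z >= 1. The bound is continuous in the points, hence it stays bounded along
    convergent families. *)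
Lemma logdd_bound x y zs : all pos (x :: y :: zs) ->
  `|logdd (x :: y :: zs)| <= \prod_(z <- x :: y :: zs) (1 + z^-1).
Proof.
move=> xs0; set xs := x :: y :: zs in xs0 *; have ik := integrable_log_kernel xs xs0.
apply: le_trans (le_normr_Rintegral _ ik) _ => //.
have -> : \prod_(z <- xs) (1 + z^-1) =
    \int[lebesgue_measure]_(s in `[0, 1]) (\prod_(z <- xs) (1 + z^-1)).
  rewrite Rintegral_cst//= lebesgue_measure_itv/= lte_fin ltr01.
  by rewrite oppr0 adde0 mulr1.
apply: le_Rintegral => //; first exact: integrable_norm.
  apply: continuous_compact_integrable; first exact: segment_compact.
  by apply: continuous_subspaceT => ?; exact: cvg_cst.
move=> s /=; rewrite in_itv/= => s01; move: (s01) => /andP[s0 s1].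
rewrite /log_kernel normrM normrX normrN -[leRHS]mul1r.
apply: ler_pM => //; first by rewrite exprn_ile1// ger0_norm.
rewrite normr_prod; elim: xs xs0 {ik} => [_|z r IH /= /andP[z0 r0]].
  by rewrite !big_nil.
rewrite !big_cons; apply: ler_pM => //; first exact: prodr_ge0; last exact: IH.
have u0 := segment_gt0 _ _ z0 s01.
rewrite normfV gtr0_norm// -[leLHS]mul1r ler_pdivrMr//.
have -> : (1 + z^-1) * (1 + s * (z - 1)) = 1 + (1 - s) / z + s * z.
  by field; rewrite gt_eqF.
by rewrite -addrA lerDl addr_ge0// ?divr_ge0 ?mulr_ge0 ?subr_ge0// ltW.
Qed.

(* Limits are taken one coordinate at a time: by [logdd_rec] the variation in
   one coordinate is its increment times a divided difference of higher order,
   which stays bounded. *)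
Lemma cvg_logdd_cat {T : Type} {F : set_system T} {FF : Filter F} {I : eqType}
    (r : seq I) (f : I -> T -> R) (l : I -> R) zs :
  (1 < size r + size zs)%N ->
  all pos zs -> {in r, forall i, 0 < l i} -> {in r, forall i, f i @ F --> l i} ->
  logdd ([seq f i t | i <- r] ++ zs) @[t --> F] --> logdd ([seq l i | i <- r] ++ zs).
Proof.
(* [zs] collects the points that no longer vary; the head of [r], replaced by its limit, joins it
   before the induction hypothesis is used. *)
elim: r zs => [|i r IH] zs szr zs0 l0 fl /=; first exact: cvg_cst.
have l0i : 0 < l i by apply: l0; rewrite mem_head.
have {}l0 : {in r, forall i, 0 < l i} by move=> j jr; apply: l0; rewrite inE jr orbT.
have fli : f i @ F --> l i by apply: fl; rewrite mem_head.
have {}fl : {in r, forall i, f i @ F --> l i}.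
  by move=> j jr; apply: fl; rewrite inE jr orbT.
rewrite -[logdd (_ :: _)](perm_logdd (map l r ++ l i :: zs)); last first.
  by rewrite perm_sym -cat_cons -cat_rcons perm_cat2r perm_sym perm_rcons.
pose g t := map (f^~ t) r.
have near_pos : \forall t \near F, all pos (f i t :: l i :: g t ++ zs).
  have near_g : \forall t \near F, all pos (g t).
    elim: r l0 fl {IH szr} @g => [|j r IH] l0 fl /=; first exact: nearW.
    near=> t; apply/andP; split; near: t.
      by apply: (cvgr_gt _ (fl j (mem_head _ _))); apply: l0; exact: mem_head.
    by apply: IH => k kr; [apply: l0|apply: fl]; rewrite inE kr orbT.
  near=> t; rewrite /= l0i all_cat zs0 andbT; apply/andP; split; near: t => //.
  exact: (cvgr_gt _ fli).
have cvgVD j : 0 < l j -> f j @ F --> l j -> 1 + (f j t)^-1 @[t --> F] --> 1 + (l j)^-1.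
  by move=> lj fj; apply: cvgD; [exact: cvg_cst|apply: cvgV; rewrite ?gt_eqF].
pose b t := \prod_(z <- f i t :: l i :: g t ++ zs) (1 + z^-1).
have cb : b @ F --> \prod_(z <- l i :: l i :: map l r ++ zs) (1 + z^-1).
  rewrite /b; under eq_cvg do rewrite !big_cons big_cat big_map.
  rewrite !big_cons big_cat big_map.
  apply: cvgM; first exact: cvgVD.
  apply: cvgM; first exact: cvg_cst.
  apply: cvgM; last exact: cvg_cst.
  under eq_cvg do rewrite big_seq; rewrite big_seq.
  by apply: cvg_big => [|j jr]; [exact: mul_continuous|apply: cvgVD; [exact: l0|exact: fl]].
have dif0 : logdd (f i t :: g t ++ zs) - logdd (l i :: g t ++ zs) @[t --> F] --> 0.
  have c0 : `|f i t - l i| * b t @[t --> F] --> 0.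
    rewrite -[0](mul0r (\prod_(z <- l i :: l i :: map l r ++ zs) (1 + z^-1))).
    apply: cvgM cb; rewrite -(normr0 R) -(subrr (l i)).
    by apply: cvg_norm; apply: cvgB => //; exact: cvg_cst.
  have cN0 : - (`|f i t - l i| * b t) @[t --> F] --> 0 by rewrite -oppr0; exact: cvgN.
  apply: (squeeze_cvgr _ cN0 c0); near=> t.
  have t0 : all pos (f i t :: l i :: g t ++ zs) by near: t.
  rewrite -ler_norml -logdd_rec// normrM ler_wpM2l// /b.
  exact: logdd_bound.
have szr' : (1 < size r + size (l i :: zs))%N by rewrite /= addnS.
have := cvgD dif0 (IH (l i :: zs) szr' _ l0 fl).
rewrite /= l0i zs0 add0r => /(_ _ isT); apply: cvg_trans.
apply: near_eq_cvg; near=> t.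
have e : logdd (g t ++ l i :: zs) = logdd (l i :: g t ++ zs).
  by apply: perm_logdd; rewrite -cat_rcons -cat_cons perm_cat2r perm_rcons.
by rewrite !fctE /= -/(g t) e subrK.
Unshelve. all: by end_near.
Qed.

Lemma cvg_logdd {T : Type} {F : set_system T} {FF : Filter F} {I : eqType}
    (r : seq I) (f : I -> T -> R) (l : I -> R) :
  {in r, forall i, 0 < l i} -> {in r, forall i, f i @ F --> l i} ->
  logdd [seq f i t | i <- r] @[t --> F] --> logdd [seq l i | i <- r].
Proof.
move=> l0 fl; case: r l0 fl => [|i [|j r]] l0 fl; first exact: cvg_cst.
  apply: (@cvg_comp _ _ _ (f i) (@ln R)); first by apply: fl; exact: mem_head.
  by apply: continuous_ln; apply: l0; exact: mem_head.
have := @cvg_logdd_cat _ F FF _ (i :: j :: r) f l [::]; rewrite cats0 /=.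
under eq_cvg do rewrite cats0.
by apply.
Qed.

(** By [logdd_rec] the difference quotient is the divided difference at x + h, x and [zs], which is
    continuous at h = 0. *)
Lemma is_derive_logdd x zs : 0 < x -> all pos zs ->
  is_derive x 1 (fun y => logdd (y :: zs)) (logdd (x :: x :: zs)).
Proof.
move=> x0 zs0.
have lim_dq : h^-1 *: (logdd (h%:A + x :: zs) - logdd (x :: zs)) @[h --> 0^'] -->
    logdd (x :: x :: zs).
  have : logdd (h%:A + x :: x :: zs) @[h --> 0^'] --> logdd (x :: x :: zs).
    (* The index [None] stands for the moving point, [Some z] for a point fixed at z. *)
    pose f (o : option R) (h : R) := if o is Some z then z else h%:A + x.
    pose l (o : option R) := if o is Some z then z else x.
    have := @cvg_logdd _ (0 : R)^' _ _ (None :: map Some (x :: zs)) f l.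
    have mE h : [seq f o h | o <- None :: map Some (x :: zs)] = h%:A + x :: x :: zs.
      by rewrite /= -map_comp map_id.
    have lE : [seq l o | o <- None :: map Some (x :: zs)] = x :: x :: zs.
      by rewrite /= -map_comp map_id.
    under eq_cvg do rewrite mE.
    rewrite lE; apply.
      move=> o; rewrite inE => /predU1P[->//|/mapP[z]].
      by rewrite inE => /predU1P[-> ->//|/(allP zs0) z0 ->].
    move=> o; rewrite inE => /predU1P[->/=|/mapP[z _ ->]]; last exact: cvg_cst.
    rewrite -[X in _ --> X](add0r x); apply: cvgD; last exact: cvg_cst.
    by rewrite -[X in _ --> X](scale0r (1 : R)); apply: cvgZr_tmp; exact: nbhs_dnbhs.
  apply: cvg_trans; apply: near_eq_cvg; near=> h.
  have xh0 : 0 < h%:A + x.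
    rewrite /GRing.scale/= mulr1 -ltrBlDr sub0r; near: h.
    by apply: nbhs_dnbhs; apply: lt_nbhsr; rewrite oppr_lt0.
  have hn0 : h != 0 by near: h; exact: nbhs_dnbhs_neq.
  rewrite -logdd_rec /= ?xh0 ?x0// addrK scalerA.
  by rewrite /GRing.scale/= mulr1 mulVf// mul1r.
split; first by apply/cvg_ex; exists (logdd (x :: x :: zs)).
exact: cvg_lim.
Unshelve. all: by end_near.
Qed.

(** [divdiff] compares the first and the last point: symmetry puts them side by side, then
    [logdd_rec] settles the case where they differ and [is_derive_logdd] the case where they
    coincide. *)
Lemma divdiff_ln k xs : (k < size xs)%N -> all pos xs ->
  divdiff (@ln R) k xs = logdd (take k.+1 xs).
Proof.
elim: k xs => [|k IH] [|a xs]//=; first by rewrite take0.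
rewrite ltnS => kxs /andP[a0 xs0].
(* [z] is the last point used at order k + 1, [mid] lists the points between the first one and [z],
   and [rest] is ignored by [divdiff]. *)
have [z [mid [rest [xsE szm]]]] :
    exists z mid rest, xs = mid ++ z :: rest /\ size mid = k.
  exists xs`_k, (take k xs), (drop k.+1 xs).
  by rewrite -drop_nth// cat_take_drop size_takel// ltnW.
have zE : xs`_k = z by rewrite xsE nth_cat szm ltnn subnn.
have take1 : take k.+1 xs = rcons mid z.
  by rewrite xsE -cat_rcons take_size_cat// size_rcons szm.
have take0 : take k xs = mid by rewrite xsE take_size_cat.
have [z0 mid0] : 0 < z /\ all pos mid.
  by move: xs0; rewrite xsE all_cat /= => /and3P[].
have dE y : 0 < y -> divdiff (@ln R) k (y :: xs) = logdd (y :: mid).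
  by move=> y0; rewrite IH/= ?take0 ?y0// ltnS ltnW.
rewrite zE take1.
have -> : logdd (a :: rcons mid z) = logdd (a :: z :: mid).
  by apply: perm_logdd; rewrite perm_cons perm_rcons.
case: eqVneq => [az|anz] /=.
  rewrite derive1E; apply: derive_val.
  (* The derivative depends only on y near a, where y > 0 and the induction hypothesis identifies
     the two functions. *)
  rewrite -az; apply: (near_eq_is_derive _ (is_derive_logdd a mid a0 mid0)); near=> y.
  by rewrite dE//; near: y; exact: (lt_nbhsr a0).
rewrite dE// IH// take1.
have -> : logdd (rcons mid z) = logdd (z :: mid) by apply: perm_logdd; rewrite perm_rcons.
by rewrite -logdd_rec /= ?a0 ?z0// mulrC mulKf// subr_eq0.
Unshelve. all: by end_near.
Qed.

(** A difference quotient of the increasing function ln, or its derivative 1/x when the points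
    coincide. This positivity permits every later division by a log[1]. *)
Lemma logdd_gt0 x y : 0 < x -> 0 < y -> 0 < logdd [:: x; y].
Proof.
move=> x0 y0; have [<-|xny] := eqVneq x y.
  have <- : x^-1 = logdd [:: x; x].
    by rewrite -(@derive_val _ _ _ _ _ _ _ (is_derive_logdd x [::] x0 isT))
       (@derive_val _ _ _ _ _ _ _ (is_derive1_ln x0)).
  by rewrite invr_gt0.
have h := logdd_rec x y [::]; rewrite /= x0 y0 in h; have {}h := h isT.
rewrite /logdd -/(logdd _) in h.
move: xny; rewrite neq_lt => /orP[xy|yx].
- by rewrite -(nmulr_rlt0 _ (_ : x - y < 0)) ?h ?subr_lt0// ltr_ln.
- by rewrite -(pmulr_rgt0 _ (_ : 0 < x - y)) ?h ?subr_gt0// ltr_ln.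
Qed.

End LogDividedDifferences.

(** * The matrix exponential: convergence, continuity and conjugation *)

Section MatrixExponential.
Context {R : realType}.

Lemma cvg_mxP {T : Type} {F : set_system T} {FF : Filter F} {m n : nat}
    (u : T -> 'M[R]_(m, n)) (l : 'M[R]_(m, n)) :
  u @ F --> l <-> forall i j, u t i j @[t --> F] --> l i j.
Proof.
split=> [ul i j|ul].
  apply/cvgrPdist_le => e e0; move/cvgrPdist_le : ul => /(_ _ e0).
  apply: filterS => t; apply: le_trans.
  rewrite [leRHS]/Num.Def.normr/= mx_normrE.
  by apply: le_trans (le_bigmax _ _ (i, j)); rewrite !mxE.
apply/cvgrPdist_le => e e0; near=> t.
rewrite /Num.Def.normr/= mx_normrE (bigmax_le _ (ltW e0))//= => i _.
rewrite !mxE/=; move: i; near: t; apply: filter_forall => /= i.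
exact: ((cvgrPdist_le _ _).1 (ul i.1 i.2)).
Unshelve. all: by end_near. Qed.

Lemma ler_normmx {m n : nat} (A : 'M[R]_(m, n)) i j : `|A i j| <= `|A|.
Proof.
rewrite [leRHS]/Num.Def.normr/= mx_normrE.
exact: le_trans (le_bigmax _ _ (i, j)).
Qed.

Lemma normmx_le {m n : nat} (A : 'M[R]_(m, n)) (c : R) : 0 <= c ->
  (forall i j, `|A i j| <= c) -> `|A| <= c.
Proof.
move=> c0 Ac; rewrite [leLHS]/Num.Def.normr/= mx_normrE.
by apply: bigmax_le.
Qed.

(** The norm is the largest absolute value of an entry, so the inner dimension appears as the number
    of terms in each entry of the product. *)
Lemma normmxM {m n p : nat} (A : 'M[R]_(m, n)) (B : 'M[R]_(n, p)) :
  `|A *m B| <= n%:R * `|A| * `|B|.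
Proof.
apply: normmx_le => [|i j]; first by rewrite !mulr_ge0.
rewrite mxE; apply: le_trans (ler_norm_sum _ _ _) _.
apply: (@le_trans _ _ (\sum_(k < n) `|A| * `|B|)).
  by apply: ler_sum => k _; rewrite normrM ler_pM// ler_normmx.
by rewrite sumr_const card_ord -mulrA mulr_natl.
Qed.

Context {n : nat}.
Implicit Types A B P Q : 'M[R]_n.

Lemma normmxX A k : `|A ^+ k| <= (n%:R * `|A|) ^+ k.
Proof.
elim: k => [|k IH].
  rewrite !expr0; apply: normmx_le => // i j.
  by rewrite mxE; case: eqP; rewrite ?normr1 ?normr0.
rewrite !exprSr; apply: le_trans (normmxM _ _) _.
by rewrite [n%:R * _]mulrC -mulrA ler_wpM2r// mulr_ge0.
Qed.

(** Induction on A^(k+1) - B^(k+1) = A^k (A - B) + (A^k - B^k) B, where each half costs C (2 C)^k.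
    The base 2 C absorbs the number of telescoping terms, so division by k! leaves an exponential
    series. *)
Lemma normmxXB A B (C : R) k : 1 <= C -> n%:R * `|A| <= C -> n%:R * `|B| <= C ->
  `|A ^+ k - B ^+ k| <= (2 * C) ^+ k * (n%:R * `|A - B|).
Proof.
move=> C1 AC BC; have C0 : 0 <= C by exact: le_trans C1.
have d0 : 0 <= n%:R * `|A - B| by rewrite mulr_ge0.
elim: k => [|k IH]; first by rewrite !expr0 subrr normr0 mul1r.
have -> : A ^+ k.+1 - B ^+ k.+1 = A ^+ k *m (A - B) + (A ^+ k - B ^+ k) *m B.
  by rewrite !exprSr mulmxBr mulmxBl addrA subrK.
apply: le_trans (ler_normD _ _) _.
have h1 : `|A ^+ k *m (A - B)| <= C * (2 * C) ^+ k * (n%:R * `|A - B|).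
  apply: le_trans (normmxM _ _) _.
  rewrite [n%:R * _]mulrC -[leLHS]mulrA ler_wpM2r//.
  apply: le_trans (normmxX _ _) _.
  apply: (@le_trans _ _ (C ^+ k)); first by rewrite lerXn2r ?nnegrE// mulr_ge0.
  rewrite exprMn mulrA -[leLHS]mul1r ler_wpM2r ?exprn_ge0//.
  by rewrite mulr_ege1// exprn_ege1// ler1n.
have h2 : `|(A ^+ k - B ^+ k) *m B| <= C * (2 * C) ^+ k * (n%:R * `|A - B|).
  apply: le_trans (normmxM _ _) _.
  rewrite [leLHS]mulrAC; apply: (@le_trans _ _ (C * `|A ^+ k - B ^+ k|)).
    by rewrite ler_wpM2r.
  by rewrite -[leRHS]mulrA ler_wpM2l.
apply: le_trans (lerD h1 h2) _.
by rewrite exprS; lra.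
Qed.

Lemma cvg_expm_entry A i j :
  cvgn (series (fun k => k`!%:R^-1 * (A ^+ k) i j)).
Proof.
apply: normed_cvg; apply: (series_le_cvg _ _ _ (is_cvg_series_exp_coeff (n%:R * `|A|))).
- by move=> k; exact: normr_ge0.
- by move=> k; apply: exp_coeff_ge0; rewrite mulr_ge0.
move=> k /=; rewrite /exp_coeff/= normrM ger0_norm// mulrC ler_wpM2r//.
exact: le_trans (ler_normmx _ _ _) (normmxX _ _).
Qed.

(** [expm] is a bare limit operator applied to the series; entrywise absolute convergence makes it a
    genuine limit. *)
Lemma cvg_expm A : series (fun k => k`!%:R^-1 *: A ^+ k) @ \oo --> expm A.
Proof.
set u := series _.
have ul : u @ \oo -->
    (\matrix_(i, j) limn (series (fun k => k`!%:R^-1 * (A ^+ k) i j)) : 'M[R]_n).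
  apply/cvg_mxP => i j; rewrite mxE.
  have -> : (fun t => u t i j) = series (fun k => k`!%:R^-1 * (A ^+ k) i j).
    apply/funext => t; rewrite /u /series/= summxE.
    by apply: eq_bigr => k _; rewrite mxE.
  exact: cvg_expm_entry.
by rewrite /expm (cvg_lim _ ul)//; exact: norm_hausdorff.
Qed.

Lemma expm_entry A i j :
  expm A i j = limn (series (fun k => k`!%:R^-1 * (A ^+ k) i j)).
Proof.
have /cvg_mxP/(_ i j) := cvg_expm A.
have -> : (fun t => series (fun k => k`!%:R^-1 *: A ^+ k) t i j) =
    series (fun k => k`!%:R^-1 * (A ^+ k) i j).
  apply/funext => t; rewrite /series/= summxE.
  by apply: eq_bigr => k _; rewrite mxE.
by move/cvg_lim => <-//.
Qed.

(** Dividing [normmxXB] by k! and summing bounds every partial sum, hence the limit, with constant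
    exp (2 C). *)
Lemma expm_lipschitz A B (C : R) : 1 <= C -> n%:R * `|A| <= C -> n%:R * `|B| <= C ->
  `|expm A - expm B| <= expR (2 * C) * (n%:R * `|A - B|).
Proof.
move=> C1 AC BC; apply: normmx_le => [|i j].
  by rewrite mulr_ge0 ?expR_ge0// mulr_ge0.
pose sA := series (fun k => k`!%:R^-1 *: A ^+ k).
pose sB := series (fun k => k`!%:R^-1 *: B ^+ k).
have sAB : `|(sA t - sB t) i j| @[t --> \oo] --> `|(expm A - expm B) i j|.
  apply: cvg_norm; move: i j; apply/cvg_mxP.
  by apply: cvgB; exact: cvg_expm.
apply: (cvgr_to_le sAB); apply: nearW => t.
set c := n%:R * `|A - B|; have c0 : 0 <= c by rewrite mulr_ge0.
apply: (@le_trans _ _ (\sum_(0 <= k < t) exp_coeff (2 * C) k * c)).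
  rewrite /sA /sB /series/= -sumrB summxE; apply: le_trans (ler_norm_sum _ _ _) _.
  apply: ler_sum => k _; rewrite -scalerBr mxE normrM ger0_norm//.
  rewrite /exp_coeff/= mulrC mulrAC ler_wpM2r//.
  exact: le_trans (ler_normmx _ _ _) (normmxXB A B C k C1 AC BC).
rewrite -mulr_suml ler_wpM2r//.
have C20 : 0 <= 2 * C by rewrite mulr_ge0// (le_trans ler01).
apply: (nondecreasing_cvgn_le _ (is_cvg_series_exp_coeff (2 * C)) t).
by apply: nondecreasing_series => k _ _; exact: exp_coeff_ge0.
Qed.

Lemma cvg_expm_comp {T : Type} {F : set_system T} {FF : ProperFilter F}
    (u : T -> 'M[R]_n) A : u @ F --> A -> expm (u t) @[t --> F] --> expm A.
Proof.
(* This [C] serves for A and for every matrix within distance 1 of it. *)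
move=> uA; pose C := 1 + n%:R * (`|A| + 1).
have C1 : 1 <= C by rewrite lerDl mulr_ge0// addr_ge0.
apply/cvgrPdist_le => e e0; near=> t.
have h1 : `|A - u t| <= 1 by near: t; move/cvgrPdist_le : uA; apply.
(* The summand 1 in [n%:R + 1] keeps the divisor positive when n = 0. *)
have h2 : `|A - u t| <= e / (expR (2 * C) * (n%:R + 1)).
  near: t; move/cvgrPdist_le : uA; apply.
  by rewrite divr_gt0// mulr_gt0 ?expR_gt0// ltr_wpDl.
apply: le_trans (expm_lipschitz _ _ C C1 _ _) _.
- by rewrite ler_wpDl// ler_wpM2l// lerDl.
- rewrite ler_wpDl// ler_wpM2l// -[u t](subrKC A) addrC.
  apply: le_trans (ler_normD _ _) _; rewrite addrC lerD2l.
  by rewrite distrC.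
move: h2; rewrite ler_pdivlMr ?mulr_gt0 ?expR_gt0 ?ltr_wpDl//.
apply: le_trans; rewrite [leLHS]mulrCA [leRHS]mulrC.
rewrite mulrA ler_wpM2r// [leLHS]mulrC ler_wpM2l ?expR_ge0//.
by rewrite lerDl.
Unshelve. all: by end_near. Qed.

(** Conjugation commutes with powers, hence with partial sums, and its entries are finite linear
    combinations, which pass to the limit. *)
Lemma expm_conj P Q A : P *m Q = 1%:M -> Q *m P = 1%:M ->
  expm (P *m A *m Q) = P *m expm A *m Q.
Proof.
move=> PQ QP.
have XE k : (P *m A *m Q) ^+ k = P *m A ^+ k *m Q.
  elim: k => [|k IH]; first by rewrite !expr0 mulmx1.
  rewrite !exprSr IH -!mulmxE -!mulmxA; congr (_ *m _); congr (_ *m _).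
  by rewrite !mulmxA QP mul1mx.
rewrite /expm; apply: cvg_lim; first exact: norm_hausdorff.
have -> : series (fun k => k`!%:R^-1 *: (P *m A *m Q) ^+ k) =
    (fun t => P *m series (fun k => k`!%:R^-1 *: A ^+ k) t *m Q).
  apply/funext => t; rewrite /series/= mulmx_sumr mulmx_suml.
  by apply: eq_bigr => k _; rewrite XE -scalemxAr -scalemxAl.
have /cvg_mxP cA := cvg_expm A; apply/cvg_mxP => i j.
under eq_cvg do rewrite mxE; rewrite mxE.
apply: cvg_big => [|k _]; first exact: add_continuous.
apply: cvgM; last exact: cvg_cst.
under eq_cvg do rewrite mxE; rewrite mxE.
apply: cvg_big => [|l _]; first exact: add_continuous.
by apply: cvgM; [exact: cvg_cst|exact: cA].
Qed.

Lemma expm_diag (d : 'rV[R]_n) : expm (diag_mx d) = diag_mx (map_mx expR d).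
Proof.
apply/matrixP => i j; rewrite expm_entry !mxE.
have XE k : (diag_mx d) ^+ k = diag_mx (map_mx (fun x => x ^+ k) d).
  elim: k => [|k IH].
    rewrite expr0 -[1]/(1%:M) -diag_const_mx; congr diag_mx.
    by apply/rowP => l; rewrite !mxE expr0.
  rewrite exprSr IH -mulmxE mulmx_diag; congr diag_mx.
  by apply/rowP => l; rewrite !mxE exprSr.
have [->|ij] := eqVneq i j; last first.
  rewrite mulr0n; under eq_fun do rewrite XE !mxE (negPf ij) mulr0n mulr0.
  apply: cvg_lim => //.
  rewrite (_ : series _ = cst 0); first exact: cvg_cst.
  by apply/funext => t; rewrite /series/= big1.
rewrite mulr1n /expR; congr (limn (series _)); apply/funext => k.
by rewrite XE !mxE eqxx mulr1n mulrC.
Qed.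

End MatrixExponential.

(** * Upper triangular 4 x 4 matrices and their logarithm for distinct eigenvalues *)

Section UpperTriangular4.
Context {R : realType}.

(** The arguments go by superdiagonals, an order in which the later triangular systems can be
    solved. *)
Definition ut4 (t1 t2 t3 t4 a12 a23 a34 a13 a24 a14 : R) : 'M[R]_4 :=
  \matrix_(i, j) nth 0 (nth [::] [:: [:: t1; a12; a13; a14];
    [:: 0; t2; a23; a24]; [:: 0; 0; t3; a34]; [:: 0; 0; 0; t4]] i) j.

Lemma ut4M t1 t2 t3 t4 a12 a23 a34 a13 a24 a14
    s1 s2 s3 s4 b12 b23 b34 b13 b24 b14 :
  ut4 t1 t2 t3 t4 a12 a23 a34 a13 a24 a14 *m ut4 s1 s2 s3 s4 b12 b23 b34 b13 b24 b14 =
  ut4 (t1 * s1) (t2 * s2) (t3 * s3) (t4 * s4)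
    (t1 * b12 + a12 * s2) (t2 * b23 + a23 * s3) (t3 * b34 + a34 * s4)
    (t1 * b13 + a12 * b23 + a13 * s3) (t2 * b24 + a23 * b34 + a24 * s4)
    (t1 * b14 + a12 * b24 + a13 * b34 + a14 * s4).
Proof.
apply/matrixP => -[[|[|[|[|//]]]] ?] -[[|[|[|[|//]]]] ?];
  rewrite !mxE !big_ord_recl big_ord0 !mxE /=; ring.
Qed.

(** A product of equations in [Type], so that [rewrite] uses it as a multirule. *)
Lemma ut4_entries t1 t2 t3 t4 a12 a23 a34 a13 a24 a14 :
  let M := ut4 t1 t2 t3 t4 a12 a23 a34 a13 a24 a14 in
  ((M.e[1, 1] = t1) * (M.e[2, 2] = t2) * (M.e[3, 3] = t3) * (M.e[4, 4] = t4) *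
   (M.e[1, 2] = a12) * (M.e[2, 3] = a23) * (M.e[3, 4] = a34) *
   (M.e[1, 3] = a13) * (M.e[2, 4] = a24) * (M.e[1, 4] = a14))%type.
Proof. by do !split; rewrite /entry mxE !inordK. Qed.

Lemma ut4_ut t1 t2 t3 t4 a12 a23 a34 a13 a24 a14 :
  ut (ut4 t1 t2 t3 t4 a12 a23 a34 a13 a24 a14).
Proof.
by apply/is_trig_mxP => -[[|[|[|[|//]]]] ?] -[[|[|[|[|//]]]] ?]; rewrite !mxE.
Qed.

Lemma ut4E (M : 'M[R]_4) : ut M ->
  M = ut4 M.e[1, 1] M.e[2, 2] M.e[3, 3] M.e[4, 4] M.e[1, 2] M.e[2, 3] M.e[3, 4]
    M.e[1, 3] M.e[2, 4] M.e[1, 4].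
Proof.
move=> /is_trig_mxP Mut; apply/matrixP => i j.
have [ij|ji] := leqP i j; last first.
  have := Mut j i ji; rewrite !mxE => ->.
  by case: i j ji => [[|[|[|[|//]]]] ?] -[[|[|[|[|//]]]] ?].
rewrite mxE /entry.
by case: i j ij => [[|[|[|[|//]]]] ?] -[[|[|[|[|//]]]] ?] //= _;
  congr (M _ _); apply: val_inj; rewrite /= inordK.
Qed.

Lemma ut4_inj t1 t2 t3 t4 a12 a23 a34 a13 a24 a14
    s1 s2 s3 s4 b12 b23 b34 b13 b24 b14 :
  ut4 t1 t2 t3 t4 a12 a23 a34 a13 a24 a14 = ut4 s1 s2 s3 s4 b12 b23 b34 b13 b24 b14 ->
  [/\ [/\ t1 = s1, t2 = s2, t3 = s3 & t4 = s4],
    [/\ a12 = b12, a23 = b23 & a34 = b34], a13 = b13, a24 = b24 & a14 = b14].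
Proof.
set M := ut4 _ _ _ _ _ _ _ _ _ _; set N := ut4 _ _ _ _ _ _ _ _ _ _ => MN.
have E p q : M.e[p, q] = N.e[p, q] by rewrite MN.
have := (E 1 1, E 2 2, E 3 3, E 4 4, E 1 2, E 2 3, E 3 4, E 1 3, E 2 4, E 1 4).
by rewrite !ut4_entries; do 9 case.
Qed.

Lemma ut4_1 : ut4 1 1 1 1 0 0 0 0 0 0 = 1%:M.
Proof.
by apply/matrixP => -[[|[|[|[|//]]]] ?] -[[|[|[|[|//]]]] ?]; rewrite !mxE.
Qed.

Lemma ut4_diag t1 t2 t3 t4 :
  ut4 t1 t2 t3 t4 0 0 0 0 0 0 = diag_mx (\row_j [:: t1; t2; t3; t4]`_j).
Proof.
by apply/matrixP => -[[|[|[|[|//]]]] ?] -[[|[|[|[|//]]]] ?]; rewrite !mxE.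
Qed.

Lemma ut4_UT t1 t2 t3 t4 a12 a23 a34 a13 a24 a14 :
  UT (ut4 t1 t2 t3 t4 a12 a23 a34 a13 a24 a14) <->
  [/\ 0 < t1, 0 < t2, 0 < t3 & 0 < t4].
Proof.
split=> [[_ M0]|[t10 t20 t30 t40]].
  by split; [have := M0 (inord 0)|have := M0 (inord 1)|have := M0 (inord 2)|
    have := M0 (inord 3)]; rewrite mxE inordK.
by split=> [|[[|[|[|[|//]]]] ?]]; [exact: ut4_ut|rewrite mxE..].
Qed.

(** With N the strictly upper triangular part, this is 1 - N + N^2 - N^3, the inverse of 1 + N
    because N^4 = 0. *)
Definition unipotent_inv (x12 x23 x34 x13 x24 x14 : R) : 'M[R]_4 :=
  ut4 1 1 1 1 (- x12) (- x23) (- x34) (x12 * x23 - x13) (x23 * x34 - x24)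
    (x12 * x24 + x13 * x34 - x12 * x23 * x34 - x14).

Lemma mul_unipotent_inv (x12 x23 x34 x13 x24 x14 : R) :
  ut4 1 1 1 1 x12 x23 x34 x13 x24 x14 *m unipotent_inv x12 x23 x34 x13 x24 x14 = 1%:M.
Proof. by rewrite ut4M -ut4_1; congr ut4; ring. Qed.

(** Entry (p, q) is a sum over the increasing paths from p to q: the product of the a's along the
    path times the divided difference of ln at the diagonal entries visited. *)
Definition log4 (t1 t2 t3 t4 a12 a23 a34 a13 a24 a14 : R) : 'M[R]_4 :=
  ut4 (ln t1) (ln t2) (ln t3) (ln t4)
    (logdd [:: t1; t2] * a12) (logdd [:: t2; t3] * a23) (logdd [:: t3; t4] * a34)
    (logdd [:: t1; t3] * a13 + logdd [:: t1; t2; t3] * a12 * a23)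
    (logdd [:: t2; t4] * a24 + logdd [:: t2; t3; t4] * a23 * a34)
    (logdd [:: t1; t4] * a14 + logdd [:: t1; t2; t4] * a12 * a24 +
     logdd [:: t1; t3; t4] * a13 * a34 +
     logdd [:: t1; t2; t3; t4] * a12 * a23 * a34).

(** With the next two lemmas, reduces the entries of [log4] at distinct points to fractions in the
    t's and their logarithms, which [field] can compare. *)
Lemma logdd2_neq (x y : R) : 0 < x -> 0 < y -> x != y ->
  logdd [:: x; y] = (ln x - ln y) / (x - y).
Proof.
move=> x0 y0 xy; have := logdd_rec x y [::]; rewrite /= x0 y0 => /(_ isT) h.
by apply: (canRL (mulfK _)); rewrite ?subr_eq0// mulrC h.
Qed.

Lemma logdd3_neq (x y z : R) : 0 < x -> 0 < y -> 0 < z -> x != z ->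
  logdd [:: x; y; z] = (logdd [:: x; y] - logdd [:: y; z]) / (x - z).
Proof.
move=> x0 y0 z0 xz; apply: (canRL (mulfK _)); rewrite ?subr_eq0// mulrC.
have -> : logdd [:: x; y; z] = logdd [:: x; z; y].
  by apply: perm_logdd; rewrite perm_cons (perm_catC [:: y] [:: z]).
have -> : logdd [:: y; z] = logdd [:: z; y].
  by apply: perm_logdd; rewrite (perm_catC [:: y] [:: z]).
by rewrite logdd_rec//= x0 y0 z0.
Qed.

Lemma logdd4_neq (x y z w : R) : 0 < x -> 0 < y -> 0 < z -> 0 < w -> x != w ->
  logdd [:: x; y; z; w] = (logdd [:: x; y; z] - logdd [:: y; z; w]) / (x - w).
Proof.
move=> x0 y0 z0 w0 xw; apply: (canRL (mulfK _)); rewrite ?subr_eq0// mulrC.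
have -> : logdd [:: x; y; z; w] = logdd [:: x; w; y; z].
  by apply: perm_logdd; rewrite perm_cons (perm_catC [:: y; z] [:: w]).
have -> : logdd [:: y; z; w] = logdd [:: w; y; z].
  by apply: perm_logdd; rewrite (perm_catC [:: y; z] [:: w]).
by rewrite logdd_rec//= x0 y0 z0 w0.
Qed.

(* The columns of P below are eigenvectors. *)
Lemma expm_log4_distinct (t1 t2 t3 t4 a12 a23 a34 a13 a24 a14 : R) :
  [/\ 0 < t1, 0 < t2, 0 < t3 & 0 < t4] -> uniq [:: t1; t2; t3; t4] ->
  expm (log4 t1 t2 t3 t4 a12 a23 a34 a13 a24 a14) =
  ut4 t1 t2 t3 t4 a12 a23 a34 a13 a24 a14.
Proof.
move=> [t10 t20 t30 t40] /=; rewrite !inE !negb_or -!andbA.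
move=> /and5P[n12 n13 n14 n23 /and3P[n24 n34 _]].
have s12 : t2 - t1 != 0 by rewrite subr_eq0 eq_sym.
have s13 : t3 - t1 != 0 by rewrite subr_eq0 eq_sym.
have s14 : t4 - t1 != 0 by rewrite subr_eq0 eq_sym.
have s23 : t3 - t2 != 0 by rewrite subr_eq0 eq_sym.
have s24 : t4 - t2 != 0 by rewrite subr_eq0 eq_sym.
have s34 : t4 - t3 != 0 by rewrite subr_eq0 eq_sym.
have r12 : t1 - t2 != 0 by rewrite subr_eq0.
have r13 : t1 - t3 != 0 by rewrite subr_eq0.
have r14 : t1 - t4 != 0 by rewrite subr_eq0.
have r23 : t2 - t3 != 0 by rewrite subr_eq0.
have r24 : t2 - t4 != 0 by rewrite subr_eq0.
have r34 : t3 - t4 != 0 by rewrite subr_eq0.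
(* Entry (p, q) of T P = P diag(t) reads (t_q - t_p) x_pq = a_pq + sum of a_pr x_rq over p < r < q,
   which is solved here one superdiagonal at a time. *)
pose x12 := a12 / (t2 - t1); pose x23 := a23 / (t3 - t2); pose x34 := a34 / (t4 - t3).
pose x13 := (a13 + a12 * x23) / (t3 - t1); pose x24 := (a24 + a23 * x34) / (t4 - t2).
pose x14 := (a14 + a12 * x24 + a13 * x34) / (t4 - t1).
pose P := ut4 1 1 1 1 x12 x23 x34 x13 x24 x14.
pose Q := unipotent_inv x12 x23 x34 x13 x24 x14.
have PQ : P *m Q = 1%:M by exact: mul_unipotent_inv.
have QP : Q *m P = 1%:M by exact: mulmx1C.
have TP : ut4 t1 t2 t3 t4 a12 a23 a34 a13 a24 a14 *m P =
    P *m ut4 t1 t2 t3 t4 0 0 0 0 0 0.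
  by rewrite !ut4M; congr ut4; rewrite /x14 /x13 /x24 /x12 /x23 /x34; field;
    rewrite ?(s12, s13, s14, s23, s24, s34).
(* The divided-difference formula is verified here: [log4] has the same eigenvectors, with
   eigenvalues ln t_i. *)
have LP : log4 t1 t2 t3 t4 a12 a23 a34 a13 a24 a14 *m P =
    P *m ut4 (ln t1) (ln t2) (ln t3) (ln t4) 0 0 0 0 0 0.
  rewrite /log4 logdd4_neq// !logdd3_neq// !logdd2_neq// !ut4M.
  by congr ut4; rewrite /x14 /x13 /x24 /x12 /x23 /x34; field;
    rewrite ?(s12, s13, s14, s23, s24, s34, r12, r13, r14, r23, r24, r34).
have -> : log4 t1 t2 t3 t4 a12 a23 a34 a13 a24 a14 =
    P *m ut4 (ln t1) (ln t2) (ln t3) (ln t4) 0 0 0 0 0 0 *m Q.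
  by rewrite -LP -mulmxA PQ mulmx1.
rewrite expm_conj// ut4_diag expm_diag.
have -> : map_mx expR (\row_j [:: ln t1; ln t2; ln t3; ln t4]`_j) =
    \row_j [:: t1; t2; t3; t4]`_j :> 'rV[R]_4.
  by apply/rowP => -[[|[|[|[|//]]]] ?]; rewrite !mxE/= lnK.
by rewrite -ut4_diag -TP -mulmxA PQ mulmx1.
Qed.

End UpperTriangular4.

(** * The logarithm of every 4 x 4 upper triangular matrix with positive diagonal *)

Section UpperTriangularLog.
Context {R : realType}.

(** Equality holds only at e = (x - y) / (j - i), which is either not positive or exceeds all small
    e > 0. *)
Lemma near_shift_neq (x y : R) (i j : nat) : (i < j)%N ->
  \forall e \near 0^'+, x + e * i%:R != y + e * j%:R.
Proof.
move=> ij; have d0 : 0 < j%:R - i%:R :> R by rewrite subr_gt0 ltr_nat.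
have eqE (e : R) : x + e * i%:R = y + e * j%:R -> e * (j%:R - i%:R) = x - y.
  by move=> h; rewrite mulrBr; lra.
have [xy|xy] := leP x y.
  near=> e; apply/negP => /eqP/eqE h.
  have : 0 < e * (j%:R - i%:R) by rewrite mulr_gt0//; near: e; exact: nbhs_right_gt.
  by rewrite h subr_gt0 ltNge xy.
near=> e; apply/negP => /eqP/eqE h.
have : e < (x - y) / (j%:R - i%:R).
  by near: e; apply: nbhs_right_lt; rewrite divr_gt0// subr_gt0.
by rewrite -h mulfK ?ltxx// gt_eqF.
Unshelve. all: by end_near. Qed.

Lemma cvg_ut4 {T : Type} {F : set_system T} {FF : Filter F}
    (t1 t2 t3 t4 a12 a23 a34 a13 a24 a14 : T -> R)
    (s1 s2 s3 s4 b12 b23 b34 b13 b24 b14 : R) :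
  t1 @ F --> s1 -> t2 @ F --> s2 -> t3 @ F --> s3 -> t4 @ F --> s4 ->
  a12 @ F --> b12 -> a23 @ F --> b23 -> a34 @ F --> b34 ->
  a13 @ F --> b13 -> a24 @ F --> b24 -> a14 @ F --> b14 ->
  ut4 (t1 u) (t2 u) (t3 u) (t4 u) (a12 u) (a23 u) (a34 u) (a13 u) (a24 u) (a14 u)
    @[u --> F] --> ut4 s1 s2 s3 s4 b12 b23 b34 b13 b24 b14.
Proof.
move=> *; apply/cvg_mxP => -[[|[|[|[|//]]]] ?] -[[|[|[|[|//]]]] ?];
  under eq_cvg do rewrite mxE /=; rewrite mxE /=; first [assumption|exact: cvg_cst].
Qed.

(* Perturb the diagonal to t_i + e i and let e tend to 0 from the right. *)
Lemma expm_log4 (t1 t2 t3 t4 a12 a23 a34 a13 a24 a14 : R) :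
  [/\ 0 < t1, 0 < t2, 0 < t3 & 0 < t4] ->
  expm (log4 t1 t2 t3 t4 a12 a23 a34 a13 a24 a14) =
  ut4 t1 t2 t3 t4 a12 a23 a34 a13 a24 a14.
Proof.
(* Indices start at 0 here, so [t1] stays in place and the others move by e, 2 e and 3 e. *)
move=> t0; pose t := [:: t1; t2; t3; t4]; pose tau i (e : R) := t`_i + e * i%:R.
have tpos i : (i < 4)%N -> 0 < t`_i by case: t0; case: i => [|[|[|[|]]]].
have ctau i : tau i e @[e --> 0^'+] --> t`_i.
  rewrite -[X in _ --> X]addr0; apply: (@cvgD _ _ _ _ _ (cst t`_i) (fun e => e * i%:R)).
    exact: cvg_cst.
  rewrite -[X in _ --> X](mul0r i%:R); apply: (@cvgM _ _ _ _ id (cst i%:R)); last exact: cvg_cst.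
  exact: cvg_within.
have cdd (r : seq nat) : all (fun i => i < 4)%N r ->
    logdd [seq tau i e | i <- r] @[e --> 0^'+] --> logdd [seq t`_i | i <- r].
  by move=> /allP r4; apply: (cvg_logdd r tau (nth 0 t)) => i /r4; [exact: tpos|move=> _; exact: ctau].
pose T e := ut4 (tau 0 e) (tau 1 e) (tau 2 e) (tau 3 e) a12 a23 a34 a13 a24 a14.
pose L e := log4 (tau 0 e) (tau 1 e) (tau 2 e) (tau 3 e) a12 a23 a34 a13 a24 a14.
have cT : T e @[e --> 0^'+] --> ut4 t1 t2 t3 t4 a12 a23 a34 a13 a24 a14.
  by apply: cvg_ut4; first [exact: cvg_cst|exact: ctau 0|exact: ctau 1|exact: ctau 2|exact: ctau 3].
have cln i : (i < 4)%N -> ln (tau i e) @[e --> 0^'+] --> ln t`_i.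
  by move=> i4; apply: (cdd [:: i]); rewrite /= i4.
have cL : L e @[e --> 0^'+] --> log4 t1 t2 t3 t4 a12 a23 a34 a13 a24 a14.
  have c (a : R) : a @[_ --> (0 : R)^'+] --> a by exact: cvg_cst.
  have c12 := cdd [:: 0; 1]%N isT.
  have c23 := cdd [:: 1; 2]%N isT.
  have c34 := cdd [:: 2; 3]%N isT.
  have c13 := cdd [:: 0; 2]%N isT.
  have c24 := cdd [:: 1; 3]%N isT.
  have c14 := cdd [:: 0; 3]%N isT.
  have c123 := cdd [:: 0; 1; 2]%N isT.
  have c234 := cdd [:: 1; 2; 3]%N isT.
  have c124 := cdd [:: 0; 1; 3]%N isT.
  have c134 := cdd [:: 0; 2; 3]%N isT.
  have c1234 := cdd [:: 0; 1; 2; 3]%N isT.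
  apply: cvg_ut4.
  - exact: cln 0 _.
  - exact: cln 1 _.
  - exact: cln 2 _.
  - exact: cln 3 _.
  - exact: (cvgM c12 (c a12)).
  - exact: (cvgM c23 (c a23)).
  - exact: (cvgM c34 (c a34)).
  - exact: (cvgD (cvgM c13 (c a13)) (cvgM (cvgM c123 (c a12)) (c a23))).
  - exact: (cvgD (cvgM c24 (c a24)) (cvgM (cvgM c234 (c a23)) (c a34))).
  - exact: (cvgD (cvgD (cvgD (cvgM c14 (c a14)) (cvgM (cvgM c124 (c a12)) (c a24)))
      (cvgM (cvgM c134 (c a13)) (c a34)))
      (cvgM (cvgM (cvgM c1234 (c a12)) (c a23)) (c a34))).
have TL : \forall e \near 0^'+, expm (L e) = T e.
  near=> e; have e0 : 0 < e by near: e; exact: nbhs_right_gt.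
  have taupos i : (i < 4)%N -> 0 < tau i e.
    by move=> /tpos ti; rewrite /tau ltr_wpDr// mulr_ge0// ltW.
  apply: expm_log4_distinct; first by split; exact: taupos.
  rewrite /= !inE !negb_or -!andbA andbT.
  by repeat (apply/andP; split); near: e; exact: near_shift_neq.
have cE : expm (L e) @[e --> 0^'+] --> expm (log4 t1 t2 t3 t4 a12 a23 a34 a13 a24 a14).
  exact: cvg_expm_comp.
have cE' : expm (L e) @[e --> 0^'+] --> ut4 t1 t2 t3 t4 a12 a23 a34 a13 a24 a14.
  by apply: cvg_trans cT; apply: near_eq_cvg; near=> e; apply/esym; near: e.
exact: (norm_cvg_unique cE cE').
Unshelve. all: by end_near. Qed.

(** In each off-diagonal entry of [log4] the unknown a_pq has the positive factor [logdd
    [:: t_p; t_q]], and the remaining terms involve only superdiagonals closer to the diagonal. The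
    a's are therefore found in turn, starting from t_p = exp y_p. *)
Lemma log4_surj (Y : 'M[R]_4) : ut Y ->
  exists t1 t2 t3 t4 a12 a23 a34 a13 a24 a14,
    [/\ 0 < t1, 0 < t2, 0 < t3 & 0 < t4] /\
    Y = log4 t1 t2 t3 t4 a12 a23 a34 a13 a24 a14.
Proof.
move=> /ut4E ->; set y1 := Y.e[1, 1]; set y2 := Y.e[2, 2]; set y3 := Y.e[3, 3].
set y4 := Y.e[4, 4].
have ne x y : logdd [:: expR x; expR y] != 0 :> R by rewrite gt_eqF// logdd_gt0// expR_gt0.
pose a12 := Y.e[1, 2] / logdd [:: expR y1; expR y2].
pose a23 := Y.e[2, 3] / logdd [:: expR y2; expR y3].
pose a34 := Y.e[3, 4] / logdd [:: expR y3; expR y4].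
pose a13 := (Y.e[1, 3] - logdd [:: expR y1; expR y2; expR y3] * a12 * a23) /
  logdd [:: expR y1; expR y3].
pose a24 := (Y.e[2, 4] - logdd [:: expR y2; expR y3; expR y4] * a23 * a34) /
  logdd [:: expR y2; expR y4].
pose a14 := (Y.e[1, 4] - logdd [:: expR y1; expR y2; expR y3; expR y4] * a12 * a23 * a34 -
  logdd [:: expR y1; expR y3; expR y4] * a13 * a34 -
  logdd [:: expR y1; expR y2; expR y4] * a12 * a24) /
  logdd [:: expR y1; expR y4].
exists (expR y1), (expR y2), (expR y3), (expR y4), a12, a23, a34, a13, a24, a14.
split; first by split; exact: expR_gt0.
rewrite /log4 !expRK; congr ut4.
- by rewrite mulrC divfK.
- by rewrite mulrC divfK.
- by rewrite mulrC divfK.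
- by rewrite [_ * a13]mulrC divfK// subrK.
- by rewrite [_ * a24]mulrC divfK// subrK.
- by rewrite [_ * a14]mulrC divfK// !subrK.
Qed.

(** By [log4_surj] both arguments are values of [log4], whose parameters are the entries of the
    exponential. *)
Lemma expm_inj : {in @ut R 4 &, injective (@expm R 4)}.
Proof.
move=> Y Z /[!inE] /log4_surj[t1 [t2 [t3 [t4 [a12 [a23 [a34 [a13 [a24 [a14 [t0 ->]]]]]]]]]]].
move=> /log4_surj[s1 [s2 [s3 [s4 [b12 [b23 [b34 [b13 [b24 [b14 [s0 ->]]]]]]]]]]].
rewrite !expm_log4// => /ut4_inj.
by move=> -[[-> -> -> ->] [-> -> ->] -> -> ->].
Qed.

Lemma log4_ut (t1 t2 t3 t4 a12 a23 a34 a13 a24 a14 : R) :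
  ut (log4 t1 t2 t3 t4 a12 a23 a34 a13 a24 a14).
Proof. exact: ut4_ut. Qed.

(** [logm] is a chosen partial inverse of [expm]; injectivity on [ut] forces its value to be the
    explicit preimage. *)
Lemma logm_ut4 (t1 t2 t3 t4 a12 a23 a34 a13 a24 a14 : R) :
  [/\ 0 < t1, 0 < t2, 0 < t3 & 0 < t4] ->
  logm (ut4 t1 t2 t3 t4 a12 a23 a34 a13 a24 a14) =
  log4 t1 t2 t3 t4 a12 a23 a34 a13 a24 a14.
Proof.
move=> t0; rewrite -expm_log4// /logm pinvKV//; first exact: expm_inj.
by rewrite inE; exact: log4_ut.
Qed.

(** Only the diagonal is made explicit, since [diag_mean] retains nothing else. *)
Lemma powm_ut4 (t1 t2 t3 t4 a12 a23 a34 a13 a24 a14 u : R) :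
  [/\ 0 < t1, 0 < t2, 0 < t3 & 0 < t4] ->
  exists b12 b23 b34 b13 b24 b14,
  powm (ut4 t1 t2 t3 t4 a12 a23 a34 a13 a24 a14) u =
  ut4 (expR (u * ln t1)) (expR (u * ln t2)) (expR (u * ln t3)) (expR (u * ln t4))
    b12 b23 b34 b13 b24 b14.
Proof.
move=> t0; rewrite /powm logm_ut4//.
have /log4_surj : ut (u *: log4 t1 t2 t3 t4 a12 a23 a34 a13 a24 a14).
  by apply/is_trig_mxP => i j ij; rewrite !mxE; have /is_trig_mxP/(_ i j ij) :=
    log4_ut t1 t2 t3 t4 a12 a23 a34 a13 a24 a14; rewrite !mxE => ->; rewrite mulr0.
move=> [s1 [s2 [s3 [s4 [b12 [b23 [b34 [b13 [b24 [b14 [s0 E]]]]]]]]]]].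
rewrite E expm_log4//; exists b12, b23, b34, b13, b24, b14.
have EE p : (u *: log4 t1 t2 t3 t4 a12 a23 a34 a13 a24 a14).e[p, p] =
    (log4 s1 s2 s3 s4 b12 b23 b34 b13 b24 b14).e[p, p] by rewrite E.
have ZE p (M : 'M[R]_4) : (u *: M).e[p, p] = u * M.e[p, p] by rewrite /entry mxE.
case: s0 => s10 s20 s30 s40; have := (EE 1, EE 2, EE 3, EE 4); rewrite !ZE !ut4_entries.
by move=> -[[[-> ->] ->] ->]; rewrite !lnK.
Qed.

End UpperTriangularLog.

(** * The Karcher equation as a triangular system, and its normalization *)

Section KarcherMean4.
Context {R : realType} {m : nat}.
Implicit Types (w : 'I_m -> R) (A : 'I_m -> 'M[R]_4) (X D : 'M[R]_4).

Lemma invmx_uniq {n : nat} (A B : 'M[R]_n) : A *m B = 1%:M -> invmx A = B.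
Proof.
move=> AB; have [Au _] := mulmx1_unit AB.
by rewrite -[invmx A]mulmx1 -AB mulmxA mulVmx// mul1mx.
Qed.

Lemma ut4_sum w (t1 t2 t3 t4 a12 a23 a34 a13 a24 a14 : 'I_m -> R) :
  \sum_(i < m) w i *: ut4 (t1 i) (t2 i) (t3 i) (t4 i)
    (a12 i) (a23 i) (a34 i) (a13 i) (a24 i) (a14 i) =
  ut4 (\sum_(i < m) w i * t1 i) (\sum_(i < m) w i * t2 i) (\sum_(i < m) w i * t3 i)
    (\sum_(i < m) w i * t4 i) (\sum_(i < m) w i * a12 i) (\sum_(i < m) w i * a23 i)
    (\sum_(i < m) w i * a34 i) (\sum_(i < m) w i * a13 i) (\sum_(i < m) w i * a24 i)
    (\sum_(i < m) w i * a14 i).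
Proof.
apply/matrixP => p q; rewrite summxE; under eq_bigr do rewrite !mxE.
rewrite mxE; case: p q => [[|[|[|[|//]]]] ?] -[[|[|[|[|//]]]] ?] //=;
  by rewrite big1// => ? _; rewrite mulr0.
Qed.

Lemma ut4_eq0 (t1 t2 t3 t4 a12 a23 a34 a13 a24 a14 : R) :
  ut4 t1 t2 t3 t4 a12 a23 a34 a13 a24 a14 = 0 <->
  [/\ [/\ t1 = 0, t2 = 0, t3 = 0 & t4 = 0],
    [/\ a12 = 0, a23 = 0 & a34 = 0], a13 = 0, a24 = 0 & a14 = 0].
Proof.
have e0 : ut4 0 0 0 0 0 0 0 0 0 0 = 0 :> 'M[R]_4.
  by apply/matrixP => -[[|[|[|[|//]]]] ?] -[[|[|[|[|//]]]] ?]; rewrite !mxE.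
split; first by rewrite -{1}e0 => /ut4_inj.
by move=> [[-> -> -> ->] [-> -> ->] -> -> ->].
Qed.

Lemma UT4P (M : 'M[R]_4) : UT M ->
  [/\ 0 < M.e[1, 1], 0 < M.e[2, 2], 0 < M.e[3, 3] & 0 < M.e[4, 4]].
Proof. by move=> [_ M0]; split; exact: M0. Qed.

(** Each off-diagonal Karcher equation has this shape: x is the unknown x_pq, its total coefficient
    is c_pq, and [g] and [h] are free of it. *)
Lemma weighted_sum_solve w (l t g h : 'I_m -> R) (x : R) :
  \sum_(i < m) w i * t i * l i != 0 ->
  \sum_(i < m) w i * (l i * (g i - x * t i) + h i) = 0 <->
  x = (\sum_(i < m) w i * t i * l i)^-1 * \sum_(i < m) w i * (l i * g i + h i).
Proof.
set c := \sum_(i < m) w i * t i * l i => c0.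
have -> : \sum_(i < m) w i * (l i * (g i - x * t i) + h i) =
    \sum_(i < m) w i * (l i * g i + h i) - x * c.
  by rewrite mulr_sumr -sumrB; apply: eq_bigr => i _; ring.
split=> [/eqP|->]; last by rewrite mulrAC mulVf// mul1r subrr.
by rewrite subr_eq0 => /eqP ->; rewrite mulrC mulfK.
Qed.

(** All summands are positive, and there is at least one because the weights sum to 1. *)
Lemma log1_coef_neq0 w A p q : (forall i, 0 < w i) -> \sum_(i < m) w i = 1 ->
  (forall i, UT (A i)) -> log1_coef w A p q != 0.
Proof.
move=> w0 w1 A_UT.
have d0 i r : 0 < (A i).e[r, r] by have [_] := A_UT i; exact.
have c0 i : 0 < w i * (A i).e[q, q] * log1 (A i).e[p, p] (A i).e[q, q].
  by rewrite !mulr_gt0// /log1 divdiff_ln//= ?d0// logdd_gt0.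
apply: contra_eqN w1 => /eqP /psumr_eq0P c_eq0.
rewrite big1 1?eq_sym ?oner_eq0// => i _.
by have := c0 i; rewrite c_eq0 ?ltxx// => j _; exact: ltW.
Qed.

(** Posed as conditions on an arbitrary [X], so that it can be compared with the Karcher equation.
    Each right-hand side involves only entries of [X] on superdiagonals closer to the diagonal. *)
Definition karcher_system w A X : Prop :=
  X.e[1, 2] = (log1_coef w A 1 2)^-1 *
    \sum_(i < m) w i * (log1 (A i).e[1, 1] (A i).e[2, 2] * (A i).e[1, 2]) /\
  X.e[2, 3] = (log1_coef w A 2 3)^-1 *
    \sum_(i < m) w i * (log1 (A i).e[2, 2] (A i).e[3, 3] * (A i).e[2, 3]) /\
  X.e[1, 3] = (log1_coef w A 1 3)^-1 *
    \sum_(i < m) w i *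
      (log1 (A i).e[1, 1] (A i).e[3, 3] *
         ((A i).e[1, 3] - X.e[1, 2] * (A i).e[2, 3] + X.e[1, 2] * X.e[2, 3] * (A i).e[3, 3]) +
       log2 (A i).e[1, 1] (A i).e[2, 2] (A i).e[3, 3] *
         ((A i).e[1, 2] - X.e[1, 2] * (A i).e[2, 2]) * ((A i).e[2, 3] - X.e[2, 3] * (A i).e[3, 3])) /\
  X.e[3, 4] = (log1_coef w A 3 4)^-1 *
    \sum_(i < m) w i * (log1 (A i).e[3, 3] (A i).e[4, 4] * (A i).e[3, 4]) /\
  X.e[2, 4] = (log1_coef w A 2 4)^-1 *
    \sum_(i < m) w i *
      (log1 (A i).e[2, 2] (A i).e[4, 4] *
         ((A i).e[2, 4] - X.e[2, 3] * (A i).e[3, 4] + X.e[2, 3] * X.e[3, 4] * (A i).e[4, 4]) +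
       log2 (A i).e[2, 2] (A i).e[3, 3] (A i).e[4, 4] *
         ((A i).e[2, 3] - X.e[2, 3] * (A i).e[3, 3]) * ((A i).e[3, 4] - X.e[3, 4] * (A i).e[4, 4])) /\
  X.e[1, 4] = (log1_coef w A 1 4)^-1 *
    \sum_(i < m) w i *
      (log1 (A i).e[1, 1] (A i).e[4, 4] *
         ((A i).e[1, 4] - X.e[1, 2] * (A i).e[2, 4] - X.e[1, 3] * (A i).e[3, 4]
          + X.e[1, 2] * X.e[2, 3] * (A i).e[3, 4] + X.e[1, 2] * X.e[2, 4] * (A i).e[4, 4]
          + X.e[1, 3] * X.e[3, 4] * (A i).e[4, 4] - X.e[1, 2] * X.e[2, 3] * X.e[3, 4] * (A i).e[4, 4]) +
       log2 (A i).e[1, 1] (A i).e[2, 2] (A i).e[4, 4] *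
         ((A i).e[1, 2] - X.e[1, 2] * (A i).e[2, 2]) *
         ((A i).e[2, 4] - X.e[2, 3] * (A i).e[3, 4] - X.e[2, 4] * (A i).e[4, 4]
          + X.e[2, 3] * X.e[3, 4] * (A i).e[4, 4]) +
       log2 (A i).e[1, 1] (A i).e[3, 3] (A i).e[4, 4] *
         ((A i).e[1, 3] - X.e[1, 2] * (A i).e[2, 3] - X.e[1, 3] * (A i).e[3, 3]
          + X.e[1, 2] * X.e[2, 3] * (A i).e[3, 3]) *
         ((A i).e[3, 4] - X.e[3, 4] * (A i).e[4, 4]) +
       log3 (A i).e[1, 1] (A i).e[2, 2] (A i).e[3, 3] (A i).e[4, 4] *
         ((A i).e[1, 2] - X.e[1, 2] * (A i).e[2, 2]) * ((A i).e[2, 3] - X.e[2, 3] * (A i).e[3, 3]) *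
         ((A i).e[3, 4] - X.e[3, 4] * (A i).e[4, 4])).

Lemma unipotent4E X : unipotent_ut X ->
  X = ut4 1 1 1 1 X.e[1, 2] X.e[2, 3] X.e[3, 4] X.e[1, 3] X.e[2, 4] X.e[1, 4].
Proof. by move=> [Xut X1]; rewrite {1}(ut4E _ Xut) /entry !X1. Qed.

(** For unipotent X the matrices X^-1 A_i and A_i have the same diagonal, so the diagonal equations
    are the hypothesis on [ln]. The six others, made explicit by [logm_ut4], are solved by
    [weighted_sum_solve]. *)
Lemma karcher_eq_unipotent w A X : (forall i, 0 < w i) -> \sum_(i < m) w i = 1 ->
  (forall i, UT (A i)) ->
  (forall p, \sum_(i < m) w i * ln (A i).e[p, p] = 0) ->
  unipotent_ut X -> karcher_eq w A X <-> karcher_system w A X.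
Proof.
move=> w0 w1 A_UT ln0 Xu.
have d0 i r : 0 < (A i).e[r, r] by have [_] := A_UT i; exact.
have E := unipotent4E X Xu.
have XUT : UT X by rewrite E; apply/ut4_UT; split; exact: ltr01.
rewrite /karcher_eq /karcher_system /=.
set x12 := X.e[1, 2] in E *; set x23 := X.e[2, 3] in E *; set x34 := X.e[3, 4] in E *.
set x13 := X.e[1, 3] in E *; set x24 := X.e[2, 4] in E *; set x14 := X.e[1, 4] in E *.
have -> : invmx X = unipotent_inv x12 x23 x34 x13 x24 x14.
  by apply: invmx_uniq; rewrite E; exact: mul_unipotent_inv.
(* In each entry above the diagonal the term - x_pq a_qq is put last, as [weighted_sum_solve]
   expects. *)
have BE i : unipotent_inv x12 x23 x34 x13 x24 x14 *m A i =
   ut4 (A i).e[1, 1] (A i).e[2, 2] (A i).e[3, 3] (A i).e[4, 4]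
    ((A i).e[1, 2] - x12 * (A i).e[2, 2]) ((A i).e[2, 3] - x23 * (A i).e[3, 3])
    ((A i).e[3, 4] - x34 * (A i).e[4, 4])
    ((A i).e[1, 3] - x12 * (A i).e[2, 3] + x12 * x23 * (A i).e[3, 3] - x13 * (A i).e[3, 3])
    ((A i).e[2, 4] - x23 * (A i).e[3, 4] + x23 * x34 * (A i).e[4, 4] - x24 * (A i).e[4, 4])
    ((A i).e[1, 4] - x12 * (A i).e[2, 4] - x13 * (A i).e[3, 4]
      + x12 * x23 * (A i).e[3, 4] + x12 * x24 * (A i).e[4, 4]
      + x13 * x34 * (A i).e[4, 4] - x12 * x23 * x34 * (A i).e[4, 4] - x14 * (A i).e[4, 4]).
  rewrite {1}(ut4E (A i) (A_UT i).1) /unipotent_inv ut4M.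
  by congr ut4; ring.
have pos4 i : [/\ 0 < (A i).e[1, 1], 0 < (A i).e[2, 2], 0 < (A i).e[3, 3] & 0 < (A i).e[4, 4]].
  by split; exact: d0.
under eq_bigr => i _ do rewrite BE (logm_ut4 _ _ _ _ _ _ _ _ _ _ (pos4 i)).
rewrite ut4_sum ut4_eq0 !ln0.
have l1 i p q : log1 (A i).e[p, p] (A i).e[q, q] = logdd [:: (A i).e[p, p]; (A i).e[q, q]].
  by rewrite /log1 divdiff_ln//= !d0.
have l2 i p q r : log2 (A i).e[p, p] (A i).e[q, q] (A i).e[r, r] =
    logdd [:: (A i).e[p, p]; (A i).e[q, q]; (A i).e[r, r]].
  by rewrite /log2 divdiff_ln//= !d0.
have l3 i p q r s : log3 (A i).e[p, p] (A i).e[q, q] (A i).e[r, r] (A i).e[s, s] =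
    logdd [:: (A i).e[p, p]; (A i).e[q, q]; (A i).e[r, r]; (A i).e[s, s]].
  by rewrite /log3 divdiff_ln//= !d0.
(* Passes from the superdiagonal order of [ut4_eq0] to the order of [karcher_system]. *)
have reorder (E0 E12 E23 E34 E13 E24 E14 F12 F23 F34 F13 F24 F14 : Prop) : E0 ->
    (E12 <-> F12) -> (E23 <-> F23) -> (E34 <-> F34) -> (E13 <-> F13) ->
    (E24 <-> F24) -> (E14 <-> F14) ->
    (UT X /\ [/\ E0, [/\ E12, E23 & E34], E13, E24 & E14]) <->
    (F12 /\ F23 /\ F13 /\ F34 /\ F24 /\ F14).
  move=> e0 /propext -> /propext -> /propext -> /propext -> /propext -> /propext ->.
  split; first by move=> [_ [_ []]].
  by move=> [? [? [? [? [? ?]]]]].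
(* [g] is the part of the factor of [log1] without the unknown [s]; [h] gathers the higher divided
   differences. *)
have solve p q (g h : 'I_m -> R) (s : R) (f f' : 'I_m -> R) :
    (forall i, f i = log1 (A i).e[p, p] (A i).e[q, q] * (g i - s * (A i).e[q, q]) + h i) ->
    (forall i, f' i = log1 (A i).e[p, p] (A i).e[q, q] * g i + h i) ->
    \sum_(i < m) w i * f i = 0 <->
    s = (log1_coef w A p q)^-1 * \sum_(i < m) w i * f' i.
  move=> fE f'E; under eq_bigr do rewrite fE.
  under [X in _ = _ * X]eq_bigr do rewrite f'E.
  by apply: weighted_sum_solve; exact: log1_coef_neq0.
apply: reorder => //.
- by apply: (solve 1 2 (fun i => (A i).e[1, 2]) (fun=> 0)) => i; rewrite addr0 ?l1.
- by apply: (solve 2 3 (fun i => (A i).e[2, 3]) (fun=> 0)) => i; rewrite addr0 ?l1.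
- by apply: (solve 3 4 (fun i => (A i).e[3, 4]) (fun=> 0)) => i; rewrite addr0 ?l1.
- apply: (solve 1 3
    (fun i => (A i).e[1, 3] - x12 * (A i).e[2, 3] + x12 * x23 * (A i).e[3, 3])
    (fun i => logdd [:: (A i).e[1, 1]; (A i).e[2, 2]; (A i).e[3, 3]] *
      ((A i).e[1, 2] - x12 * (A i).e[2, 2]) * ((A i).e[2, 3] - x23 * (A i).e[3, 3])));
    by move=> i; rewrite ?(l1, l2); ring.
- apply: (solve 2 4
    (fun i => (A i).e[2, 4] - x23 * (A i).e[3, 4] + x23 * x34 * (A i).e[4, 4])
    (fun i => logdd [:: (A i).e[2, 2]; (A i).e[3, 3]; (A i).e[4, 4]] *
      ((A i).e[2, 3] - x23 * (A i).e[3, 3]) * ((A i).e[3, 4] - x34 * (A i).e[4, 4])));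
    by move=> i; rewrite ?(l1, l2); ring.
- apply: (solve 1 4
    (fun i => (A i).e[1, 4] - x12 * (A i).e[2, 4] - x13 * (A i).e[3, 4]
      + x12 * x23 * (A i).e[3, 4] + x12 * x24 * (A i).e[4, 4]
      + x13 * x34 * (A i).e[4, 4] - x12 * x23 * x34 * (A i).e[4, 4])
    (fun i => logdd [:: (A i).e[1, 1]; (A i).e[2, 2]; (A i).e[4, 4]] *
         ((A i).e[1, 2] - x12 * (A i).e[2, 2]) *
         ((A i).e[2, 4] - x23 * (A i).e[3, 4] - x24 * (A i).e[4, 4]
          + x23 * x34 * (A i).e[4, 4]) +
       logdd [:: (A i).e[1, 1]; (A i).e[3, 3]; (A i).e[4, 4]] *
         ((A i).e[1, 3] - x12 * (A i).e[2, 3] - x13 * (A i).e[3, 3]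
          + x12 * x23 * (A i).e[3, 3]) *
         ((A i).e[3, 4] - x34 * (A i).e[4, 4]) +
       logdd [:: (A i).e[1, 1]; (A i).e[2, 2]; (A i).e[3, 3]; (A i).e[4, 4]] *
         ((A i).e[1, 2] - x12 * (A i).e[2, 2]) * ((A i).e[2, 3] - x23 * (A i).e[3, 3]) *
         ((A i).e[3, 4] - x34 * (A i).e[4, 4])));
    by move=> i; rewrite ?(l1, l2, l3); ring.
Qed.

(** Entry (p, p) of the equation is the weighted sum of ln a_pp - ln x_pp, that is - ln x_pp, so
    x_pp = 1. *)
Lemma karcher_eq_diag1 w A X : (forall i, UT (A i)) ->
  (forall p, \sum_(i < m) w i * ln (A i).e[p, p] = 0) -> \sum_(i < m) w i = 1 ->
  karcher_eq w A X -> unipotent_ut X.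
Proof.
move=> A_UT ln0 w1 [XUT eq0].
have := ut4E X XUT.1; case: (UT4P X XUT).
set s1 := X.e[1, 1]; set s2 := X.e[2, 2]; set s3 := X.e[3, 3]; set s4 := X.e[4, 4].
move=> s10 s20 s30 s40 E.
have s1n : s1 != 0 by rewrite gt_eqF.
have s2n : s2 != 0 by rewrite gt_eqF.
have s3n : s3 != 0 by rewrite gt_eqF.
have s4n : s4 != 0 by rewrite gt_eqF.
(* X is its diagonal times the unipotent matrix obtained by dividing row p by s_p; [U] inverts the
   latter. *)
pose U := unipotent_inv (X.e[1, 2] / s1) (X.e[2, 3] / s2) (X.e[3, 4] / s3)
  (X.e[1, 3] / s1) (X.e[2, 4] / s2) (X.e[1, 4] / s1).
have XV : invmx X = U *m ut4 s1^-1 s2^-1 s3^-1 s4^-1 0 0 0 0 0 0.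
  have XE : X = ut4 s1 s2 s3 s4 0 0 0 0 0 0 *m
      ut4 1 1 1 1 (X.e[1, 2] / s1) (X.e[2, 3] / s2) (X.e[3, 4] / s3)
        (X.e[1, 3] / s1) (X.e[2, 4] / s2) (X.e[1, 4] / s1).
    by rewrite {1}E ut4M; congr ut4; field; rewrite ?s1n ?s2n ?s3n.
  apply: invmx_uniq; rewrite {1}XE mulmxA -(mulmxA (ut4 _ _ _ _ _ _ _ _ _ _)).
  rewrite mul_unipotent_inv mulmx1 ut4M -ut4_1.
  by congr ut4; rewrite ?mulr0 ?mul0r ?addr0 ?divff.
have BE i : exists a12 a23 a34 a13 a24 a14, logm (invmx X *m A i) =
    ut4 (ln (A i).e[1, 1] - ln s1) (ln (A i).e[2, 2] - ln s2)
      (ln (A i).e[3, 3] - ln s3) (ln (A i).e[4, 4] - ln s4) a12 a23 a34 a13 a24 a14.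
  have [d1 d2 d3 d4] := UT4P (A i) (A_UT i).
  rewrite XV (ut4E (A i) (A_UT i).1) !ut4M logm_ut4 /log4; last first.
    by rewrite !mul1r; split; rewrite mulr_gt0// invr_gt0.
  do 6 eexists.
  by congr ut4; rewrite mul1r mulrC ln_div// !ut4_entries.
have EE p (y : R) : (forall i, (logm (invmx X *m A i)).e[p, p] = ln (A i).e[p, p] - ln y) ->
    0 < y -> y = 1.
  move=> yE y0; have := congr1 (fun M : 'M[R]_4 => M.e[p, p]) eq0.
  rewrite /entry summxE mxE.
  under eq_bigr => i _ do rewrite mxE -/(entry _ p p) yE mulrBr.
  rewrite sumrB ln0 -mulr_suml w1 mul1r sub0r => /eqP.
  by rewrite oppr_eq0 ln_eq0// => /eqP.
have {}EE : [/\ s1 = 1, s2 = 1, s3 = 1 & s4 = 1].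
  by split; [apply: (EE 1%N)|apply: (EE 2)|apply: (EE 3)|apply: (EE 4)] => // i;
    have [? [? [? [? [? [? ->]]]]]] := BE i; rewrite ut4_entries.
case: EE => e1 e2 e3 e4; split; first exact: XUT.1.
rewrite E e1 e2 e3 e4.
by case=> [[|[|[|[|//]]]] ?]; rewrite mxE.
Qed.

Lemma karcher_eqP w A X : (forall i, 0 < w i) -> \sum_(i < m) w i = 1 ->
  (forall i, UT (A i)) ->
  (forall p, \sum_(i < m) w i * ln (A i).e[p, p] = 0) ->
  karcher_eq w A X <-> unipotent_ut X /\ karcher_system w A X.
Proof.
move=> w0 w1 A_UT ln0; split=> [XA|[Xu XA]]; last exact/karcher_eq_unipotent.
have Xu : unipotent_ut X by exact: (karcher_eq_diag1 w A).
by split=> //; exact/karcher_eq_unipotent.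
Qed.

(** The formulas determine the entries successively, each from entries already shown equal. *)
Lemma karcher_system_unique w A X Y : unipotent_ut X -> unipotent_ut Y ->
  karcher_system w A X -> karcher_system w A Y -> X = Y.
Proof.
move=> Xu Yu [x12 [x23 [x13 [x34 [x24 x14]]]]] [y12 [y23 [y13 [y34 [y24 y14]]]]].
have e12 : X.e[1, 2] = Y.e[1, 2] by rewrite x12 y12.
have e23 : X.e[2, 3] = Y.e[2, 3] by rewrite x23 y23.
have e34 : X.e[3, 4] = Y.e[3, 4] by rewrite x34 y34.
have e13 : X.e[1, 3] = Y.e[1, 3] by rewrite x13 y13 e12 e23.
have e24 : X.e[2, 4] = Y.e[2, 4] by rewrite x24 y24 e23 e34.
have e14 : X.e[1, 4] = Y.e[1, 4] by rewrite x14 y14 e12 e23 e34 e13 e24.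
by rewrite (unipotent4E X Xu) (unipotent4E Y Yu) e12 e23 e34 e13 e24 e14.
Qed.

Lemma karcher_system_solvable w A : exists2 X, unipotent_ut X & karcher_system w A X.
Proof.
have uU x12 x23 x34 x13 x24 x14 : unipotent_ut (ut4 1 1 1 1 x12 x23 x34 x13 x24 x14 : 'M[R]_4).
  by split=> [|[[|[|[|[|//]]]] ?]]; [exact: ut4_ut|rewrite mxE..].
(* The entries are left open; each equation then defines its own in terms of those already fixed,
   and [reflexivity] fills it in. *)
refine (ex_intro2 _ _ _ (uU ?[x12] ?[x23] ?[x34] ?[x13] ?[x24] ?[x14]) _).
rewrite /karcher_system !ut4_entries.
do 5 (split; first reflexivity); reflexivity.
Qed.

Lemma karcher_unique w A X : karcher_eq w A X ->
  (forall Y, karcher_eq w A Y -> X = Y) -> karcher w A = X.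
Proof. by move=> XA XU; apply: xget_unique => // Y [YA _]; exact/esym/XU. Qed.

Lemma karcher_systemP w A : (forall i, 0 < w i) -> \sum_(i < m) w i = 1 ->
  (forall i, UT (A i)) ->
  (forall p, \sum_(i < m) w i * ln (A i).e[p, p] = 0) ->
  [/\ karcher_eq w A (karcher w A), unipotent_ut (karcher w A),
    karcher_system w A (karcher w A) &
    forall Y, karcher_eq w A Y -> karcher w A = Y].
Proof.
move=> w0 w1 A_UT ln0; have eqP X := karcher_eqP w A X w0 w1 A_UT ln0.
have [X Xu XA] := karcher_system_solvable w A.
have XE : karcher_eq w A X by exact/eqP.
have XU Y : karcher_eq w A Y -> X = Y.
  by move=> /eqP[Yu YA]; exact: (karcher_system_unique w A).
by rewrite (karcher_unique w A X XE XU).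
Qed.

Lemma UT4M X D : UT X -> UT D -> UT (X *m D) /\ forall p, (X *m D) p p = X p p * D p p.
Proof.
move=> XUT DUT; case: (UT4P X XUT) (UT4P D DUT) => x1 x2 x3 x4 [d1 d2 d3 d4].
rewrite (ut4E X XUT.1) (ut4E D DUT.1) ut4M; split.
  by apply/ut4_UT; split; rewrite mulr_gt0.
by case=> [[|[|[|[|//]]]] ?]; rewrite !mxE.
Qed.

Lemma UT4_prod A : (forall i, UT (A i)) ->
  UT (\prod_(i < m) A i) /\ forall p, (\prod_(i < m) A i) p p = \prod_(i < m) A i p p.
Proof.
move=> A_UT.
(* [UT] accompanies the diagonal entry through the induction, as triangularity is what makes the
   diagonal multiplicative. *)
suff prodP p : UT (\prod_(i < m) A i) /\ (\prod_(i < m) A i) p p = \prod_(i < m) A i p p.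
  by split=> [|p]; [exact: (prodP ord0).1|exact: (prodP p).2].
apply: (big_ind2 (fun (M : 'M[R]_4) x => UT M /\ M p p = x)) => [|M x N y [Mu <-] [Nu <-]|i _].
- by rewrite mxE eqxx; split=> //; rewrite -[1]/(1%:M) -ut4_1; apply/ut4_UT.
- by have [MN MNp] := UT4M M N Mu Nu; split=> //; exact: MNp.
- by split.
Qed.

Lemma UT4_powm X (u : R) : UT X ->
  UT (powm X u) /\ forall p, powm X u p p = expR (u * ln (X p p)).
Proof.
move=> XUT; have X0 := UT4P X XUT; rewrite (ut4E X XUT.1).
have [? [? [? [? [? [? ->]]]]]] := powm_ut4 _ _ _ _ X.e[1, 2] X.e[2, 3] X.e[3, 4]
    X.e[1, 3] X.e[2, 4] X.e[1, 4] u X0.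
split; first by apply/ut4_UT; split; exact: expR_gt0.
by case=> [[|[|[|[|//]]]] ?]; rewrite !mxE.
Qed.

Lemma UT_unitmx X : UT X -> X \in unitmx.
Proof.
move=> [Xut X0]; rewrite unitmxE -det_tr det_trig// unitfE.
by apply/prodf_neq0 => i _; rewrite mxE gt_eqF.
Qed.

(** On diagonals products and powers act as for scalars, so D_pp is the weighted geometric mean of
    the a_pp. *)
Lemma diag_mean_UT w A : (forall i, UT (A i)) -> UT (diag_mean w A) /\
  forall p, ln (diag_mean w A p p) = \sum_(i < m) w i * ln (A i p p).
Proof.
move=> A_UT; have pU i := UT4_powm (A i) (w i) (A_UT i).
have [MU Mp] := UT4_prod (fun i => powm (A i) (w i)) (fun i => (pU i).1).
rewrite /diag_mean /diag_part; split=> [|p].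
  split=> [|i]; last by rewrite !mxE eqxx mulr1n; exact: MU.2.
  by rewrite /ut /= tr_diag_mx diag_mx_is_trig.
rewrite !mxE eqxx mulr1n Mp (eq_bigr _ (fun i _ => (pU i).2 p)).
by rewrite -expR_sum expRK.
Qed.

Lemma diag_mean_diag w A p q : p != q -> diag_mean w A p q = 0.
Proof. by move=> pq; rewrite mxE (negPf pq) mulr0n. Qed.

Lemma invmx_diag_UT D : UT D -> (forall p q, p != q -> D p q = 0) ->
  UT (invmx D) /\ forall p, invmx D p p = (D p p)^-1.
Proof.
move=> [_ D0] Dd; have -> : invmx D = diag_mx (\row_i (D i i)^-1).
  apply: invmx_uniq; apply/matrixP => i j; rewrite mul_mx_diag !mxE.
  have [->|ij] := eqVneq i j; first by rewrite divff// gt_eqF.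
  by rewrite (Dd i j ij) mul0r.
split=> [|p]; last by rewrite !mxE eqxx.
split=> [|i]; last by rewrite !mxE eqxx mulr1n invr_gt0.
by rewrite /ut /= tr_diag_mx diag_mx_is_trig.
Qed.

(** Left translation cancels: (D^-1 X)^-1 (D^-1 A_i) = X^-1 A_i. *)
Lemma karcher_eq_translate w A D X : UT D -> UT (invmx D) ->
  karcher_eq w (fun i => invmx D *m A i) (invmx D *m X) <-> karcher_eq w A X.
Proof.
move=> DU DVU; have Du := UT_unitmx D DU.
have UTE : UT (invmx D *m X) <-> UT X.
  split=> XU; last exact: (UT4M _ _ DVU XU).1.
  by rewrite -(mulKVmx Du X); exact: (UT4M _ _ DU XU).1.
have eqE : UT X -> (fun i => invmx (invmx D *m X) *m (invmx D *m A i)) =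
    (fun i => invmx X *m A i).
  move=> XU; apply/funext => i; have Xu := UT_unitmx X XU.
  have -> : invmx (invmx D *m X) = invmx X *m D.
    by apply: invmx_uniq; rewrite mulmxA mulmxK// mulVmx.
  by rewrite -mulmxA mulKVmx.
have sumE : UT X -> \sum_(i < m) w i *: logm (invmx (invmx D *m X) *m (invmx D *m A i)) =
    \sum_(i < m) w i *: logm (invmx X *m A i).
  by move=> XU; apply: eq_bigr => i _; rewrite (congr1 (@^~ i) (eqE XU)).
split=> [[/UTE XU]|[XU]]; first by rewrite sumE.
by rewrite -sumE// => X0; split; first exact/UTE.
Qed.

End KarcherMean4.

Theorem theorem5p6 (R : realType) (m : nat) (w : 'I_m -> R)
    (A : 'I_m -> 'M[R]_4)
    (w_gt0 : forall i, 0 < w i) (w_sum1 : \sum_(i < m) w i = 1)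
    (A_UT : forall i, UT (A i)) :
  let D := diag_mean w A in
  let A' := fun i => invmx D *m A i in
  let X' := karcher w A' in
  karcher w A = D *m X' /\
  unipotent_ut X' /\
  X'.e[1, 2] = (log1_coef w A' 1 2)^-1 *
    \sum_(i < m) w i * (log1 (A' i).e[1, 1] (A' i).e[2, 2] * (A' i).e[1, 2]) /\
  X'.e[2, 3] = (log1_coef w A' 2 3)^-1 *
    \sum_(i < m) w i * (log1 (A' i).e[2, 2] (A' i).e[3, 3] * (A' i).e[2, 3]) /\
  X'.e[1, 3] = (log1_coef w A' 1 3)^-1 *
    \sum_(i < m) w i *
      (log1 (A' i).e[1, 1] (A' i).e[3, 3] *
         ((A' i).e[1, 3] - X'.e[1, 2] * (A' i).e[2, 3] + X'.e[1, 2] * X'.e[2, 3] * (A' i).e[3, 3]) +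
       log2 (A' i).e[1, 1] (A' i).e[2, 2] (A' i).e[3, 3] *
         ((A' i).e[1, 2] - X'.e[1, 2] * (A' i).e[2, 2]) * ((A' i).e[2, 3] - X'.e[2, 3] * (A' i).e[3, 3])) /\
  X'.e[3, 4] = (log1_coef w A' 3 4)^-1 *
    \sum_(i < m) w i * (log1 (A' i).e[3, 3] (A' i).e[4, 4] * (A' i).e[3, 4]) /\
  X'.e[2, 4] = (log1_coef w A' 2 4)^-1 *
    \sum_(i < m) w i *
      (log1 (A' i).e[2, 2] (A' i).e[4, 4] *
         ((A' i).e[2, 4] - X'.e[2, 3] * (A' i).e[3, 4] + X'.e[2, 3] * X'.e[3, 4] * (A' i).e[4, 4]) +
       log2 (A' i).e[2, 2] (A' i).e[3, 3] (A' i).e[4, 4] *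
         ((A' i).e[2, 3] - X'.e[2, 3] * (A' i).e[3, 3]) * ((A' i).e[3, 4] - X'.e[3, 4] * (A' i).e[4, 4])) /\
  X'.e[1, 4] = (log1_coef w A' 1 4)^-1 *
    \sum_(i < m) w i *
      (log1 (A' i).e[1, 1] (A' i).e[4, 4] *
         ((A' i).e[1, 4] - X'.e[1, 2] * (A' i).e[2, 4] - X'.e[1, 3] * (A' i).e[3, 4]
          + X'.e[1, 2] * X'.e[2, 3] * (A' i).e[3, 4] + X'.e[1, 2] * X'.e[2, 4] * (A' i).e[4, 4]
          + X'.e[1, 3] * X'.e[3, 4] * (A' i).e[4, 4] - X'.e[1, 2] * X'.e[2, 3] * X'.e[3, 4] * (A' i).e[4, 4]) +
       log2 (A' i).e[1, 1] (A' i).e[2, 2] (A' i).e[4, 4] *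
         ((A' i).e[1, 2] - X'.e[1, 2] * (A' i).e[2, 2]) *
         ((A' i).e[2, 4] - X'.e[2, 3] * (A' i).e[3, 4] - X'.e[2, 4] * (A' i).e[4, 4]
          + X'.e[2, 3] * X'.e[3, 4] * (A' i).e[4, 4]) +
       log2 (A' i).e[1, 1] (A' i).e[3, 3] (A' i).e[4, 4] *
         ((A' i).e[1, 3] - X'.e[1, 2] * (A' i).e[2, 3] - X'.e[1, 3] * (A' i).e[3, 3]
          + X'.e[1, 2] * X'.e[2, 3] * (A' i).e[3, 3]) *
         ((A' i).e[3, 4] - X'.e[3, 4] * (A' i).e[4, 4]) +
       log3 (A' i).e[1, 1] (A' i).e[2, 2] (A' i).e[3, 3] (A' i).e[4, 4] *
         ((A' i).e[1, 2] - X'.e[1, 2] * (A' i).e[2, 2]) * ((A' i).e[2, 3] - X'.e[2, 3] * (A' i).e[3, 3]) *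
         ((A' i).e[3, 4] - X'.e[3, 4] * (A' i).e[4, 4])).
Proof.
move=> D A' X'.
have [DU lnD] := diag_mean_UT w A A_UT.
have [DVU DVd] := invmx_diag_UT D DU (diag_mean_diag w A).
have A'_UT i : UT (A' i) by exact: (UT4M _ _ DVU (A_UT i)).1.
(* The choice of D serves this: ln D_pp is the weighted mean of the ln a_pp, so division by D_pp
   centres them. *)
have ln0 p : \sum_(i < m) w i * ln (A' i).e[p, p] = 0.
  under eq_bigr => i _.
    rewrite /entry (UT4M _ _ DVU (A_UT i)).2 DVd [X in ln X]mulrC ln_div; first last.
    - exact: DU.2.
    - exact: (A_UT i).2.
    rewrite mulrBr; over.
  by rewrite sumrB -mulr_suml w_sum1 mul1r lnD subrr.
have [X'E X'u X'sys X'uniq] := karcher_systemP w A' w_gt0 w_sum1 A'_UT ln0.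
have Du := UT_unitmx D DU.
have tr X : karcher_eq w A' (invmx D *m X) <-> karcher_eq w A X.
  exact: karcher_eq_translate.
(* The six formulas are [karcher_system w A' X'] unfolded. *)
split; last by split.
(* By translation D X' solves the original equation, and any solution Y yields D^-1 Y, which equals
   X' by uniqueness. *)
apply: karcher_unique => [|Y /(tr Y).2 YE].
  by apply: (tr _).1; rewrite mulKmx.
by rewrite /X' (X'uniq _ YE) mulKVmx.
Qed.
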